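(* Let $\mathcal A$ be a non-trivial interval of $\mathbb{R}$, $n\ge1$, $\tilde\phi_1,\ldots,\tilde\phi_n\in\tilde{\mathcal S}^{\mathcal A}$ and $N\in\mathbb N$. Then for every $\rho>0$ such that the Borel transforms of all $\tilde\phi_j$ extend holomorphically to $S(\rho,\mathcal A)$, every $\tau\in\mathbb{R}$ and every $\varepsilon>0$, \[ \|\tilde\phi_1\cdots\tilde\phi_n\|_{\rho,\tau+\varepsilon}\le\max(1,\varepsilon^{-(n-1)})\|\tilde\phi_1\|_{\rho,\tau}\cdots\|\tilde\phi_n\|_{\rho,\tau},\qquad \Big\|\frac{d^N\tilde\phi_1}{dz^N}\Big\|_{\rho,\tau+\varepsilon}\le\frac{N!}{\varepsilon^N}\|\tilde\phi_1\|_{\rho,\tau}. \]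
   Context: $\mathcal B:\sum_{n\ge0}a_nz^{-n-1}\mapsto\sum a_n\zeta^n/n!$ is the formal Borel transform. For $\rho>0$, $S(\rho,\mathcal A)\defeq\{|\zeta|<\rho\}\cup\{re^{i\theta}:r>0,\theta\in\mathcal A\}$. A formal series $\tilde\phi\in\mathbb{C}[[z^{-1}]]$ is 1-summable in the directions of $\mathcal A$ if $\tilde\phi=c+\mathcal B^{-1}\hat\varphi$ with $c\in\mathbb{C}$, $\hat\varphi\in\mathbb{C}\{\zeta\}$ extending analytically to some $S(\rho,\mathcal A)$ with $|\hat\varphi(\zeta)|\le Ce^{\tau|\zeta|}$ there for some $C>0,\tau\in\mathbb{R}$; $\tilde{\mathcal S}^{\mathcal A}$ is the set of such series. For $\tilde\phi=c+\mathcal B^{-1}\hat\varphi$ with $\hat\varphi$ holomorphic on $S(\rho,\mathcal A)$, $\|\tilde\phi\|_{\rho,\tau}\defeq|c|+\sup_{S(\rho,\mathcal A)}e^{-\tau|\zeta|}|\hat\varphi(\zeta)|\in[0,+\infty]$. *)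

(* Defs.v *)
From Stdlib Require Import Reals List Factorial.
From Coquelicot Require Import Coquelicot.
Open Scope R_scope.

(* A formal series  phi = sum_{k>=0} a k * z^{-k}  in C[[z^{-1}]] is given by
   its coefficient sequence  a : nat -> C. *)
Definition fseries := nat -> C.

Definition nontrivial_interval (A : R -> Prop) : Prop :=
  (forall x y t, A x -> A y -> x <= t <= y -> A t) /\
  (exists x y, A x /\ A y /\ x < y).

Definition inS (rho : R) (A : R -> Prop) (zeta : C) : Prop :=
  Cmod zeta < rho \/
  exists r theta, 0 < r /\ A theta /\ zeta = (r * cos theta, r * sin theta).

Definition Copen (U : C -> Prop) : Prop :=
  forall z, U z -> exists r, 0 < r /\ forall w, Cmod (w - z) < r -> U w.

(* f is holomorphic on the (not necessarily open) set U: f is complex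
   differentiable at every point of some open set containing U. *)
Definition holomorphic_on (U : C -> Prop) (f : C -> C) : Prop :=
  exists V, Copen V /\ (forall z, U z -> V z) /\
    forall z, V z -> ex_derive (K := C_AbsRing) (V := C_NormedModule) f z.

(* Borel germ of a = c + B^{-1} hat-phi, with c = a 0 and
   hat-phi(zeta) = sum_{k>=0} a (k+1) zeta^k / k! *)
Definition borel_coef (a : fseries) (k : nat) : C :=
  Cmult (a (S k)) (RtoC (/ INR (fact k))).

Definition borel_ext (rho : R) (A : R -> Prop) (a : fseries) (f : C -> C) : Prop :=
  holomorphic_on (inS rho A) f /\
  exists r, 0 < r /\ forall zeta, Cmod zeta < r ->
    is_pseries (K := C_AbsRing) (V := C_NormedModule) (borel_coef a) zeta (f zeta).

Definition summable1 (A : R -> Prop) (a : fseries) : Prop :=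
  exists rho f Cst tau, 0 < rho /\ 0 < Cst /\ borel_ext rho A a f /\
    forall zeta, inS rho A zeta -> Cmod (f zeta) <= Cst * exp (tau * Cmod zeta).

Definition snorm (rho : R) (A : R -> Prop) (tau : R) (a : fseries) (f : C -> C) : Rbar :=
  Rbar_plus (Finite (Cmod (a 0%nat)))
    (Lub_Rbar (fun x => exists zeta, inS rho A zeta /\
                 x = exp (- tau * Cmod zeta) * Cmod (f zeta))).

Definition fmul (a b : fseries) : fseries :=
  fun n => sum_n (fun k => Cmult (a k) (b (n - k)%nat)) n.

Definition fone : fseries := fun n => match n with O => RtoC 1 | _ => RtoC 0 end.

Definition fprod (n : nat) (phi : nat -> fseries) : fseries :=
  fold_right fmul fone (map phi (seq 0 n)).

(* d/dz (sum a_k z^{-k}) = sum_k (-k) a_k z^{-k-1} *)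
Definition fderiv (a : fseries) : fseries :=
  fun n => match n with
           | O => RtoC 0
           | S k => Cmult (RtoC (- INR k)) (a k)
           end.

Definition fderiv_n (N : nat) (a : fseries) : fseries := Nat.iter N fderiv a.

Definition Rbar_prod (n : nat) (x : nat -> Rbar) : Rbar :=
  fold_right Rbar_mult (Finite 1) (map x (seq 0 n)).

(* Main.v *)
(* The Borel transform turns products into convolutions: with constant terms a, b and Borel
   transforms f1, f2, the product has Borel transform a f2 + b f1 + f1 * f2, where
   (f1 * f2)(z) = int_0^z f1(w) f2(z - w) dw is taken along the segment [0, z]; since S(rho, A) is
   star-shaped this extends holomorphically to S(rho, A).  Weighting f1 with tau and f2 with
   tau + eps bounds f1 * f2 with the single loss 1 / eps, so that
     |ab|_(tau + eps) <= max(1, 1 / eps) |a|_tau |b|_(tau + eps),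
   and induction on the number of factors gives the first inequality without splitting eps.
   The operator d/dz becomes multiplication by - z, and x^N exp(- eps x) <= N! / eps^N.
   Any other extension agrees with these by unique continuation along segments from 0.  Holomorphy
   is only pointwise complex differentiability here, so this rests on Goursat's lemma and
   Cauchy's formula. *)

Require Import Defs.
From Stdlib Require Import Reals List Factorial.
From Coquelicot Require Import Coquelicot.
From Stdlib Require Import Lra Lia Classical ClassicalEpsilon FunctionalExtensionality.
Open Scope R_scope.

(** Pointwise differentiability gives no continuity of the derivative, which rules out Green's
    theorem and differentiation under the integral sign. Circles are therefore reached from
    Goursat's rectangles through the exponential map. The convolution is shown holomorphic by a
    Lipschitz bound on difference quotients: it depends only on a bound for the integrand, so it
    survives integration over the parameter.

    An open neighbourhood of S(rho, A) on which an extension is differentiable need be neither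
    star-shaped nor of uniform width. Each argument thus works with a single compact segment [0, z]
    and a tube around it.

    Norms may be infinite, and [Rbar_mult] sets 0 * infinity = 0. A product estimate with one
    infinite norm is then not automatic: if the other norm is 0, the product series itself has to be
    shown to have norm 0.

    In the induction only the head of the product is weighted by tau; the tail is already measured
    at tau + eps, and the last factor passes from tau to tau + eps at no cost. Hence n factors pay
    max(1, 1/eps) exactly n - 1 times, and a power of this maximum is the maximum of the powers. *)

(** * Complex continuity and differentiability *)

Definition ccont (f : C -> C) (z : C) : Prop :=
  forall eps, 0 < eps -> exists del, 0 < del /\
    forall w, Cmod (w - z) < del -> Cmod (f w - f z) < eps.

Definition cder (f : C -> C) (z l : C) : Prop :=
  forall eps, 0 < eps -> exists del, 0 < del /\
    forall w, Cmod (w - z) < del ->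
      Cmod (f w - f z - l * (w - z)) <= eps * Cmod (w - z).

(** The balls of this structure are discs for [Cmod], so the library's notions unfold to [ccont] and
    [cder] by conversion. *)
Notation CA := (AbsRing_NormedModule C_AbsRing).

Lemma cder_eq f z l m : cder f z l -> l = m -> cder f z m.
Proof. now intros H <-. Qed.

Lemma ccont_continuous f z :
  ccont f z <-> continuous (T := CA) (U := CA) f z.
Proof.
  split; intros H.
  - intros P [e He]. destruct (H e (cond_pos e)) as [d [Hd Hw]].
    exists (mkposreal d Hd). intros w Hb. apply He. apply Hw. exact Hb.
  - intros e He.
    destruct (H (fun y => Cmod (y - f z) < e)) as [d Hd].
    { exists (mkposreal e He). intros y Hy. exact Hy. }
    exists d. split; [apply cond_pos|]. intros w Hw. apply Hd. exact Hw.
Qed.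

Lemma cder_is_derive f z l :
  cder f z l <-> is_derive (K := C_AbsRing) (V := CA) f z l.
Proof.
  split; intros H.
  - split; [apply is_linear_scal_l|].
    intros x Hx. assert (E := is_filter_lim_locally_unique (V := CA) z x Hx); subst x.
    intros e. destruct (H e (cond_pos e)) as [d [Hd Hw]].
    exists (mkposreal d Hd). intros w Hb.
    specialize (Hw w Hb). change (Cmod (f w - f z - (w - z) * l) <= e * Cmod (w - z)).
    replace ((w - z) * l)%C with (l * (w - z))%C by ring. exact Hw.
  - destruct H as [_ H]. intros e He.
    destruct (H z (fun P HP => HP) (mkposreal e He)) as [d Hd].
    exists d. split; [apply cond_pos|]. intros w Hw.
    specialize (Hd w Hw).
    change (Cmod (f w - f z - (w - z) * l) <= e * Cmod (w - z)) in Hd.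
    replace (l * (w - z))%C with ((w - z) * l)%C by ring. exact Hd.
Qed.

(* The target [C_NormedModule] carries the product uniform structure, the source the one of [Cmod]. *)
Lemma ex_derive_cder f z :
  ex_derive (K := C_AbsRing) (V := C_NormedModule) f z <-> exists l, cder f z l.
Proof.
  split; intros [l H]; exists l.
  - destruct H as [_ H]. intros e He.
    destruct (H z (fun P HP => HP) (mkposreal e He)) as [d Hd].
    exists d. split; [apply cond_pos|]. intros w Hw.
    specialize (Hd w Hw).
    change (Cmod (f w - f z - (w - z) * l) <= e * Cmod (w - z)) in Hd.
    replace (l * (w - z))%C with ((w - z) * l)%C by ring. exact Hd.
  - split; [apply is_linear_scal_l|].
    intros x Hx. assert (E := is_filter_lim_locally_unique (V := CA) z x Hx); subst x.
    intros e. destruct (H e (cond_pos e)) as [d [Hd Hw]].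
    exists (mkposreal d Hd). intros w Hb.
    specialize (Hw w Hb). change (Cmod (f w - f z - (w - z) * l) <= e * Cmod (w - z)).
    replace ((w - z) * l)%C with (l * (w - z))%C by ring. exact Hw.
Qed.

Lemma cder_ccont f z l : cder f z l -> ccont f z.
Proof.
  intros H. apply ccont_continuous.
  apply (ex_derive_continuous (K := C_AbsRing) (V := CA)).
  exists l. now apply cder_is_derive.
Qed.

Lemma ccont_comp f g z : ccont g z -> ccont f (g z) -> ccont (fun w => f (g w)) z.
Proof. rewrite !ccont_continuous. apply (continuous_comp (U := CA) (V := CA) (W := CA)). Qed.

Lemma ccont_const c z : ccont (fun _ => c) z.
Proof. apply ccont_continuous. apply (continuous_const (U := CA) (V := CA)). Qed.

Lemma ccont_id z : ccont (fun w => w) z.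
Proof. apply ccont_continuous. apply (continuous_id (U := CA)). Qed.

Lemma ccont_plus f g z : ccont f z -> ccont g z -> ccont (fun w => f w + g w)%C z.
Proof. rewrite !ccont_continuous. apply (continuous_plus (U := CA) (V := CA)). Qed.

Lemma ccont_opp f z : ccont f z -> ccont (fun w => - f w)%C z.
Proof. rewrite !ccont_continuous. apply (continuous_opp (U := CA) (V := CA)). Qed.

Lemma ccont_minus f g z : ccont f z -> ccont g z -> ccont (fun w => f w - g w)%C z.
Proof. intros. apply ccont_plus; [easy|]. now apply ccont_opp. Qed.

Lemma ccont_mult f g z : ccont f z -> ccont g z -> ccont (fun w => f w * g w)%C z.
Proof. rewrite !ccont_continuous. apply (continuous_mult (K := C_AbsRing) (U := CA)). Qed.

Lemma cder_const c z : cder (fun _ => c) z 0.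
Proof. apply cder_is_derive. apply (is_derive_const (K := C_AbsRing) (V := CA)). Qed.

Lemma cder_id z : cder (fun w => w) z 1.
Proof. apply cder_is_derive. apply (is_derive_id (K := C_AbsRing)). Qed.

Lemma cder_plus f g z l m : cder f z l -> cder g z m -> cder (fun w => f w + g w)%C z (l + m).
Proof. rewrite !cder_is_derive. apply (is_derive_plus (K := C_AbsRing) (V := CA)). Qed.

Lemma cder_opp f z l : cder f z l -> cder (fun w => - f w)%C z (- l).
Proof. rewrite !cder_is_derive. apply (is_derive_opp (K := C_AbsRing) (V := CA)). Qed.

Lemma cder_minus f g z l m : cder f z l -> cder g z m -> cder (fun w => f w - g w)%C z (l - m).
Proof. intros. apply cder_plus; [easy|]. now apply cder_opp. Qed.

Lemma cder_mult f g z l m :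
  cder f z l -> cder g z m -> cder (fun w => f w * g w)%C z (l * g z + f z * m).
Proof.
  rewrite !cder_is_derive. intros Hf Hg.
  apply (is_derive_mult (K := C_AbsRing)); [easy..|]. intros; apply Cmult_comm.
Qed.

Lemma cder_comp f g z l m :
  cder f (g z) l -> cder g z m -> cder (fun w => f (g w)) z (m * l).
Proof. rewrite !cder_is_derive. apply (is_derive_comp (K := C_AbsRing) (V := CA)). Qed.

Lemma cder_ext_loc f g z l r :
  0 < r -> (forall w, Cmod (w - z) < r -> f w = g w) -> cder f z l -> cder g z l.
Proof.
  intros Hr He. rewrite !cder_is_derive. apply (is_derive_ext_loc (K := C_AbsRing) (V := CA)).
  exists (mkposreal r Hr). intros w Hw. now apply He.
Qed.

Lemma Cmod_minus_sym z w : Cmod (z - w) = Cmod (w - z).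
Proof. rewrite <- Cmod_opp. f_equal. ring. Qed.

Lemma Cmod_triangle_rev z w : Cmod z - Cmod w <= Cmod (z - w).
Proof.
  pose proof (Cmod_triangle (z - w) w) as H.
  replace (z - w + w)%C with z in H by ring. lra.
Qed.

Lemma ccont_inv (z : C) : z <> 0 -> ccont Cinv z.
Proof.
  intros Hz e He. assert (H0 : 0 < Cmod z) by (apply -> Cmod_gt_0; exact Hz).
  set (a := Cmod z) in *.
  (* The first bound forces |w| > a / 2, hence |w z| > a^2 / 2; the second then makes |z - w| / |w
     z| smaller than e. *)
  exists (Rmin (a / 2) (e * a * a / 2)). split.
  { apply Rmin_glb_lt; [lra|]. apply Rdiv_lt_0_compat; [|lra].
    repeat apply Rmult_lt_0_compat; lra. }
  intros w Hw.
  assert (H1 : Cmod (w - z) < a / 2) by (eapply Rlt_le_trans; [apply Hw|apply Rmin_l]).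
  assert (H2 : Cmod (w - z) < e * a * a / 2) by (eapply Rlt_le_trans; [apply Hw|apply Rmin_r]).
  assert (H3 : a / 2 < Cmod w).
  { pose proof (Cmod_triangle_rev z w). rewrite Cmod_minus_sym in H. fold a in H. lra. }
  assert (Hw0 : w <> 0) by (apply <- Cmod_gt_0; lra).
  replace (/ w - / z)%C with ((z - w) / (w * z))%C by (field; auto).
  rewrite Cmod_div by now apply Cmult_neq_0. rewrite Cmod_mult. fold a.
  rewrite Cmod_minus_sym. apply Rlt_div_l.
  { apply Rmult_lt_0_compat; lra. }
  apply Rlt_le_trans with (1 := H2). assert (0 < e * a) by now apply Rmult_lt_0_compat. nra.
Qed.

Lemma cder_inv (z : C) : z <> 0 -> cder Cinv z (- (/ z * / z)).
Proof.
  intros Hz e He. assert (H0 : 0 < Cmod z) by (apply -> Cmod_gt_0; exact Hz).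
  (* The remainder factors as (1/w - 1/z) (1/z) (z - w), so continuity of the inverse with tolerance
     e |z| suffices. *)
  destruct (ccont_inv z Hz (e * Cmod z)) as [d [Hd Hw]]; [now apply Rmult_lt_0_compat|].
  exists (Rmin d (Cmod z)). split; [now apply Rmin_glb_lt|].
  intros w Hlt.
  assert (H1 : Cmod (w - z) < d) by (eapply Rlt_le_trans; [apply Hlt|apply Rmin_l]).
  assert (H2 : Cmod (w - z) < Cmod z) by (eapply Rlt_le_trans; [apply Hlt|apply Rmin_r]).
  assert (Hw0 : w <> 0).
  { intros ->. replace (0 - z)%C with (- z)%C in H2 by ring. rewrite Cmod_opp in H2. lra. }
  specialize (Hw w H1).
  replace (/ w - / z - - (/ z * / z) * (w - z))%C with ((/ w - / z) * / z * (z - w))%C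
    by (field; auto).
  rewrite !Cmod_mult, (Cmod_minus_sym z w), Cmod_inv by easy.
  apply Rmult_le_compat_r; [apply Cmod_ge_0|].
  apply Rlt_le, Rlt_div_l; [easy|]. lra.
Qed.

Definition cdif (f : C -> C) (z : C) : Prop := exists l, cder f z l.

Lemma cdif_ccont f z : cdif f z -> ccont f z.
Proof. intros [l H]. exact (cder_ccont _ _ _ H). Qed.

Lemma cdif_const c z : cdif (fun _ => c) z.
Proof. eexists; apply cder_const. Qed.

Lemma cdif_id z : cdif (fun w => w) z.
Proof. eexists; apply cder_id. Qed.

Lemma cdif_plus f g z : cdif f z -> cdif g z -> cdif (fun w => f w + g w)%C z.
Proof. intros [l H] [m K]. eexists; apply (cder_plus _ _ _ _ _ H K). Qed.

Lemma cdif_opp f z : cdif f z -> cdif (fun w => - f w)%C z.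
Proof. intros [l H]. eexists; apply (cder_opp _ _ _ H). Qed.

Lemma cdif_minus f g z : cdif f z -> cdif g z -> cdif (fun w => f w - g w)%C z.
Proof. intros [l H] [m K]. eexists; apply (cder_minus _ _ _ _ _ H K). Qed.

Lemma cdif_mult f g z : cdif f z -> cdif g z -> cdif (fun w => f w * g w)%C z.
Proof. intros [l H] [m K]. eexists; apply (cder_mult _ _ _ _ _ H K). Qed.

Lemma cdif_comp f g z : cdif f (g z) -> cdif g z -> cdif (fun w => f (g w)) z.
Proof. intros [l H] [m K]. eexists; apply (cder_comp _ _ _ _ _ H K). Qed.

Lemma cdif_inv (g : C -> C) z : g z <> 0 -> cdif g z -> cdif (fun w => / g w)%C z.
Proof. intros H. apply (cdif_comp Cinv). exists (- (/ g z * / g z))%C. exact (cder_inv _ H). Qed.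

Lemma cdif_inv_sub (z w : C) : w <> z -> cdif (fun v => / (v - z))%C w.
Proof.
  intros H. apply (cdif_inv (fun v => v - z)%C).
  - intros E. now apply Ceq_minus in E.
  - apply cdif_minus; [apply cdif_id|apply cdif_const].
Qed.

Lemma cdif_Cauchy_kernel (z w : C) : w <> z -> cdif (fun v => v * / (v - z))%C w.
Proof. intros H. apply cdif_mult; [apply cdif_id|now apply cdif_inv_sub]. Qed.

Lemma cdif_pow f n z : cdif f z -> cdif (fun w => (f w) ^ n)%C z.
Proof.
  intros Hf. induction n as [|n IH].
  - exact (cdif_const 1%C z).
  - apply (cdif_mult _ _ _ Hf IH).
Qed.

Lemma cdif_ext_loc f g z r :
  0 < r -> (forall w, Cmod (w - z) < r -> f w = g w) -> cdif f z -> cdif g z.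
Proof. intros Hr He [l H]. exists l. exact (cder_ext_loc _ _ _ _ _ Hr He H). Qed.

(** * Integrals of complex functions over real intervals *)

Notation CR := C_R_CompleteNormedModule.

(** The integrand is kept as a function of a complex variable, so that the complex rules for
    continuity and derivatives apply to it directly. *)
Definition cint (f : C -> C) (a b : R) : C := RInt (V := CR) (fun t => f (RtoC t)) a b.

Definition cseg (f : C -> C) (a b : R) : Prop := forall t, a <= t <= b -> ccont f (RtoC t).

Lemma Cmod_RtoC_minus s t : Cmod (RtoC s - RtoC t) = Rabs (s - t).
Proof. now rewrite <- RtoC_minus, Cmod_R. Qed.

Lemma ccont_continuous_R f t :
  ccont f (RtoC t) -> continuous (T := R_UniformSpace) (U := CR) (fun s => f (RtoC s)) t.
Proof.
  intros H. apply (filterlim_locally (U := CR)). intros e.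
  destruct (H e (cond_pos e)) as [d [Hd Hw]].
  exists (mkposreal d Hd). intros s Hs.
  apply (norm_compat1 (V := C_R_NormedModule)).
  change (Rabs (s - t) < d) in Hs. rewrite <- Cmod_RtoC_minus in Hs.
  rewrite <- Cmod_norm. exact (Hw _ Hs).
Qed.

Lemma cseg_ex_RInt f a b : a <= b -> cseg f a b -> ex_RInt (V := CR) (fun t => f (RtoC t)) a b.
Proof.
  intros Hab H. apply ex_RInt_continuous.
  intros t. rewrite Rmin_left, Rmax_right by easy. intros Ht.
  now apply ccont_continuous_R, H.
Qed.

Lemma cseg_is_RInt f a b : a <= b -> cseg f a b ->
  is_RInt (V := CR) (fun t => f (RtoC t)) a b (cint f a b).
Proof. intros Hab H. apply (RInt_correct (V := CR)). now apply cseg_ex_RInt. Qed.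

Lemma cint_ext f g a b : a <= b -> (forall t, a <= t <= b -> f (RtoC t) = g (RtoC t)) ->
  cint f a b = cint g a b.
Proof.
  intros Hab H. apply (RInt_ext (V := CR)). intros t. rewrite Rmin_left, Rmax_right by easy.
  intros Ht. apply H. lra.
Qed.

Lemma cint_plus f g a b : a <= b -> cseg f a b -> cseg g a b ->
  cint (fun w => f w + g w)%C a b = (cint f a b + cint g a b)%C.
Proof.
  intros Hab Hf Hg. apply (is_RInt_unique (V := CR)).
  apply (is_RInt_plus (V := CR)); now apply cseg_is_RInt.
Qed.

(** Linearity in [CR] covers real scalars only; a complex factor mixes the real and imaginary parts,
    which are integrated separately. *)
Lemma cint_scal c f a b : a <= b -> cseg f a b ->
  cint (fun w => c * f w)%C a b = (c * cint f a b)%C.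
Proof.
  intros Hab Hf. apply (is_RInt_unique (V := CR)).
  pose proof (cseg_is_RInt _ _ _ Hab Hf) as H.
  assert (H1 := is_RInt_fct_extend_fst (U := R_NormedModule) (V := R_NormedModule) _ _ _ _ H).
  assert (H2 := is_RInt_fct_extend_snd (U := R_NormedModule) (V := R_NormedModule) _ _ _ _ H).
  apply (is_RInt_fct_extend_pair (U := R_NormedModule) (V := R_NormedModule)
     (fun t => c * f (RtoC t))%C).
  - apply (is_RInt_minus (V := R_NormedModule)); now apply (is_RInt_scal (V := R_NormedModule)).
  - apply (is_RInt_plus (V := R_NormedModule)); now apply (is_RInt_scal (V := R_NormedModule)).
Qed.

Lemma cseg_scal c f a b : cseg f a b -> cseg (fun w => c * f w)%C a b.
Proof. intros H t Ht. apply ccont_mult; [apply ccont_const|auto]. Qed.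

Lemma cseg_plus f g a b : cseg f a b -> cseg g a b -> cseg (fun w => f w + g w)%C a b.
Proof. intros H K t Ht. apply ccont_plus; auto. Qed.

Lemma cseg_minus f g a b : cseg f a b -> cseg g a b -> cseg (fun w => f w - g w)%C a b.
Proof. intros H K t Ht. apply ccont_minus; auto. Qed.

Lemma cint_minus f g a b : a <= b -> cseg f a b -> cseg g a b ->
  cint (fun w => f w - g w)%C a b = (cint f a b - cint g a b)%C.
Proof.
  intros Hab Hf Hg. apply (is_RInt_unique (V := CR)).
  apply (is_RInt_minus (V := CR)); now apply cseg_is_RInt.
Qed.

Lemma cint_const c a b : cint (fun _ => c) a b = (RtoC (b - a) * c)%C.
Proof. unfold cint. rewrite (RInt_const (V := CR)). apply scal_R_Cmult. Qed.

Lemma cint_Chasles f a b c : a <= b -> b <= c -> cseg f a c ->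
  (cint f a b + cint f b c)%C = cint f a c.
Proof.
  intros Hab Hbc H. apply (RInt_Chasles (V := CR)); apply cseg_ex_RInt; auto;
  intros t Ht; apply H; lra.
Qed.

Lemma cint_le f g a b lg : a <= b -> cseg f a b -> is_RInt g a b lg ->
  (forall t, a <= t <= b -> Cmod (f (RtoC t)) <= g t) -> Cmod (cint f a b) <= lg.
Proof.
  intros Hab Hf Hg H. rewrite Cmod_norm.
  apply (norm_RInt_le (V := C_R_NormedModule) (fun t => f (RtoC t)) g a b); auto.
  - intros t Ht. rewrite <- Cmod_norm. auto.
  - now apply cseg_is_RInt.
Qed.

Lemma cint_le_const f a b M : a <= b -> cseg f a b ->
  (forall t, a <= t <= b -> Cmod (f (RtoC t)) <= M) -> Cmod (cint f a b) <= (b - a) * M.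
Proof.
  intros Hab Hf H. apply (cint_le f (fun _ => M)); auto.
  apply (is_RInt_const (V := R_NormedModule)).
Qed.

(** Restricting the complex remainder estimate to real increments gives the derivative along the
    real axis. *)
Lemma cint_FTC f df a b : a <= b ->
  (forall t, a <= t <= b -> cder f (RtoC t) (df (RtoC t))) -> cseg df a b ->
  cint df a b = (f (RtoC b) - f (RtoC a))%C.
Proof.
  intros Hab Hf Hdf. apply (is_RInt_unique (V := CR)).
  apply (is_RInt_derive (V := CR) (fun t => f (RtoC t)));
    intros t; rewrite Rmin_left, Rmax_right by easy; intros Ht.
  - split; [apply is_linear_scal_l|].
    intros x Hx. assert (E := is_filter_lim_locally_unique (V := R_NormedModule) t x Hx); subst x.
    intros e. destruct (Hf t Ht e (cond_pos e)) as [d [Hd Hw]].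
    exists (mkposreal d Hd). intros s Hs. change (Rabs (s - t) < d) in Hs.
    change (norm (minus s t)) with (Rabs (s - t)).
    rewrite <- Cmod_RtoC_minus in *.
    specialize (Hw _ Hs). rewrite <- Cmod_norm.
    rewrite scal_R_Cmult.
    change (Cmod (f (RtoC s) - f (RtoC t) - RtoC (s - t) * df (RtoC t)) <= e * Cmod (RtoC s - RtoC t)).
    rewrite RtoC_minus. replace ((s - t) * df (RtoC t))%C with (df (RtoC t) * (s - t))%C by ring.
    exact Hw.
  - now apply ccont_continuous_R, Hdf.
Qed.

(** * Goursat's lemma for rectangles *)

(** The contour integral along the boundary of [a, b] x [c, d], counterclockwise: bottom minus top,
    then right minus left with the factor [Ci] from dz = i dy. *)
Definition rect_int (G : C -> C) (a b c d : R) : C :=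
  (cint (fun w => G (w + Ci * c)) a b - cint (fun w => G (w + Ci * d)) a b
   + Ci * (cint (fun w => G (b + Ci * w)) c d - cint (fun w => G (a + Ci * w)) c d))%C.

Definition crect (G : C -> C) (a b c d : R) : Prop :=
  forall x y, a <= x <= b -> c <= y <= d -> ccont G (RtoC x + Ci * RtoC y).

Lemma crect_h G a b c d y : crect G a b c d -> c <= y <= d -> cseg (fun w => G (w + Ci * y)%C) a b.
Proof.
  intros H Hy t Ht. apply (ccont_comp G (fun w => w + Ci * y)%C).
  - apply ccont_plus; [apply ccont_id|apply ccont_const].
  - now apply H.
Qed.

Lemma crect_v G a b c d x : crect G a b c d -> a <= x <= b -> cseg (fun w => G (x + Ci * w)%C) c d.
Proof.
  intros H Hx t Ht. apply (ccont_comp G (fun w => x + Ci * w)%C).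
  - apply ccont_plus; [apply ccont_const|]. apply ccont_mult; [apply ccont_const|apply ccont_id].
  - now apply H.
Qed.

Lemma rect_int_split_h G a b e c d : a <= b -> b <= e -> c <= d -> crect G a e c d ->
  rect_int G a e c d = (rect_int G a b c d + rect_int G b e c d)%C.
Proof.
  intros Hab Hbe Hcd H. unfold rect_int.
  rewrite <- (cint_Chasles (fun w => G (w + Ci * c)%C) a b e); auto;
    [|apply (crect_h _ _ _ _ _ _ H); lra].
  rewrite <- (cint_Chasles (fun w => G (w + Ci * d)%C) a b e); auto;
    [|apply (crect_h _ _ _ _ _ _ H); lra].
  ring.
Qed.

Lemma rect_int_split_v G a b c d e : a <= b -> c <= d -> d <= e -> crect G a b c e ->
  rect_int G a b c e = (rect_int G a b c d + rect_int G a b d e)%C.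
Proof.
  intros Hab Hbe Hcd H. unfold rect_int.
  rewrite <- (cint_Chasles (fun w => G (a + Ci * w)%C) c d e); auto;
    [|apply (crect_v _ _ _ _ _ _ H); lra].
  rewrite <- (cint_Chasles (fun w => G (b + Ci * w)%C) c d e); auto;
    [|apply (crect_v _ _ _ _ _ _ H); lra].
  ring.
Qed.

Lemma rect_int_minus G K a b c d : a <= b -> c <= d -> crect G a b c d -> crect K a b c d ->
  rect_int (fun w => G w - K w)%C a b c d = (rect_int G a b c d - rect_int K a b c d)%C.
Proof.
  intros Hab Hcd HG HK. unfold rect_int.
  rewrite (cint_minus (fun w => G (w + Ci * c)%C) (fun w => K (w + Ci * c)%C)); auto;
    [|apply (crect_h _ _ _ _ _ _ HG); lra|apply (crect_h _ _ _ _ _ _ HK); lra].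
  rewrite (cint_minus (fun w => G (w + Ci * d)%C) (fun w => K (w + Ci * d)%C)); auto;
    [|apply (crect_h _ _ _ _ _ _ HG); lra|apply (crect_h _ _ _ _ _ _ HK); lra].
  rewrite (cint_minus (fun w => G (a + Ci * w)%C) (fun w => K (a + Ci * w)%C)); auto;
    [|apply (crect_v _ _ _ _ _ _ HG); lra|apply (crect_v _ _ _ _ _ _ HK); lra].
  rewrite (cint_minus (fun w => G (b + Ci * w)%C) (fun w => K (b + Ci * w)%C)); auto;
    [|apply (crect_v _ _ _ _ _ _ HG); lra|apply (crect_v _ _ _ _ _ _ HK); lra].
  ring.
Qed.

(** Each side contributes the difference of [F] at its end points, and these differences cancel
    around the boundary. *)
Lemma rect_int_primitive F G a b c d : a <= b -> c <= d -> crect G a b c d ->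
  (forall z, cder F z (G z)) -> rect_int G a b c d = 0.
Proof.
  intros Hab Hcd HG HF. unfold rect_int.
  assert (Hh : forall y, c <= y <= d ->
    cint (fun w => G (w + Ci * y)%C) a b = (F (b + Ci * y) - F (a + Ci * y))%C).
  { intros y Hy. apply (cint_FTC (fun w => F (w + Ci * y)%C)); auto.
    - intros t Ht. rewrite <- (Cmult_1_l (G _)).
      apply (cder_comp F (fun w => w + Ci * y)%C); [apply HF|].
      replace (RtoC 1) with (1 + 0)%C by ring.
      apply cder_plus; [apply cder_id|apply cder_const].
    - apply (crect_h _ _ _ _ _ _ HG); lra. }
  assert (Hv : forall x, a <= x <= b ->
    (Ci * cint (fun w => G (x + Ci * w)%C) c d = F (x + Ci * d) - F (x + Ci * c))%C).
  { intros x Hx. assert (Hs := crect_v _ _ _ _ _ _ HG Hx).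
    rewrite <- cint_scal by auto.
    apply (cint_FTC (fun w => F (x + Ci * w)%C)); auto.
    - intros t Ht.
      apply (cder_comp F (fun w => x + Ci * w)%C); [apply HF|].
      apply (cder_eq _ _ (0 + (0 * RtoC t + Ci * 1))%C); [|ring].
      apply cder_plus; [apply cder_const|].
      apply (cder_mult (fun _ => Ci) (fun w => w)); [apply cder_const|apply cder_id].
    - now apply cseg_scal. }
  rewrite !Hh by lra.
  replace (Ci * (cint (fun w => G (b + Ci * w)) c d - cint (fun w => G (a + Ci * w)) c d))%C
    with (Ci * cint (fun w => G (b + Ci * w)) c d - Ci * cint (fun w => G (a + Ci * w)) c d)%C
    by ring.
  rewrite !Hv by lra. ring.
Qed.

Lemma rect_int_le G a b c d B : a <= b -> c <= d -> crect G a b c d ->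
  (forall x y, a <= x <= b -> c <= y <= d -> Cmod (G (RtoC x + Ci * RtoC y)%C) <= B) ->
  Cmod (rect_int G a b c d) <= 2 * ((b - a) + (d - c)) * B.
Proof.
  intros Hab Hcd HG HB. unfold rect_int.
  assert (Hh : forall y, c <= y <= d -> Cmod (cint (fun w => G (w + Ci * y)%C) a b) <= (b - a) * B).
  { intros y Hy. apply cint_le_const; auto. apply (crect_h _ _ _ _ _ _ HG); lra. }
  assert (Hv : forall x, a <= x <= b -> Cmod (cint (fun w => G (x + Ci * w)%C) c d) <= (d - c) * B).
  { intros y Hy. apply cint_le_const; auto. apply (crect_v _ _ _ _ _ _ HG); lra. }
  eapply Rle_trans; [apply Cmod_triangle|]. rewrite Cmod_mult, Cmod_Ci.
  unfold Cminus.
  pose proof (Cmod_triangle (cint (fun w => G (w + Ci * c)%C) a b) (- cint (fun w => G (w + Ci * d)%C) a b)).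
  pose proof (Cmod_triangle (cint (fun w => G (b + Ci * w)%C) c d) (- cint (fun w => G (a + Ci * w)%C) c d)).
  rewrite Cmod_opp in *.
  pose proof (Hh c ltac:(lra)). pose proof (Hh d ltac:(lra)).
  pose proof (Hv a ltac:(lra)). pose proof (Hv b ltac:(lra)). lra.
Qed.

Lemma half_pow_small K d : 0 <= K -> 0 < d -> exists N, forall n, (N <= n)%nat -> K / 2 ^ n < d.
Proof.
  intros HK Hd.
  destruct (pow_lt_1_zero (1/2) ltac:(rewrite Rabs_pos_eq; lra) (d / (K + 1))) as [N HN].
  { apply Rdiv_lt_0_compat; lra. }
  exists N. intros n Hn. specialize (HN n Hn).
  rewrite Rabs_pos_eq in HN by (apply pow_le; lra).
  apply Rlt_div_r in HN; [|lra].
  unfold Rdiv in *. rewrite Rmult_1_l, pow_inv in HN.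
  assert (0 < / 2 ^ n) by (apply Rinv_0_lt_compat, pow_lt; lra). nra.
Qed.

(** * Bisection of rectangles *)

Section Bisection.
Variables (a c L M : R) (good : R -> R -> nat -> Prop).
Hypotheses (HL : 0 <= L) (HM : 0 <= M).
Let l n := L / 2 ^ n.
Let m n := M / 2 ^ n.
Hypothesis Hsplit : forall x y n,
  a <= x -> x + l n <= a + L -> c <= y -> y + m n <= c + M ->
  good x y (S n) -> good (x + l (S n)) y (S n) ->
  good x (y + m (S n)) (S n) -> good (x + l (S n)) (y + m (S n)) (S n) -> good x y n.
Hypothesis Hloc : forall u v, a <= u <= a + L -> c <= v <= c + M ->
  exists N, forall n x y, (N <= n)%nat ->
  a <= x -> x + l n <= a + L -> c <= y -> y + m n <= c + M ->
  x <= u <= x + l n -> y <= v <= y + m n -> good x y n.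

Lemma halves K n : K / 2 ^ n = 2 * (K / 2 ^ S n).
Proof. simpl. field. apply pow_nonzero. lra. Qed.

Definition inside (p : R * R) n :=
  a <= fst p /\ fst p + l n <= a + L /\ c <= snd p /\ snd p + m n <= c + M.

Lemma l_pos n : 0 <= l n.
Proof. apply Rdiv_le_0_compat; [easy|apply pow_lt; lra]. Qed.
Lemma m_pos n : 0 <= m n.
Proof. apply Rdiv_le_0_compat; [easy|apply pow_lt; lra]. Qed.

Lemma bad_child n p : inside p n -> ~ good (fst p) (snd p) n ->
  exists q, inside q (S n) /\ ~ good (fst q) (snd q) (S n) /\
    fst p <= fst q /\ fst q + l (S n) <= fst p + l n /\
    snd p <= snd q /\ snd q + m (S n) <= snd p + m n.
Proof.
  intros Hp Hb. destruct p as [x y]. unfold inside in *; simpl fst in *; simpl snd in *.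
  apply NNPP. intros Hno. apply Hb.
  pose proof (l_pos (S n)). pose proof (m_pos (S n)).
  pose proof (halves L n). pose proof (halves M n). fold (l n) (l (S n)) (m n) (m (S n)) in *.
  assert (Hq : forall x' y', (x' = x \/ x' = x + l (S n)) -> (y' = y \/ y' = y + m (S n)) ->
     good x' y' (S n)).
  { intros x' y' Hx Hy. apply NNPP. intros Hn. apply Hno. exists (x', y'). simpl fst; simpl snd.
    repeat split; auto; lra. }
  apply Hsplit; try lra; apply Hq; auto.
Qed.

(** Here [good x y n] speaks of the rectangle with lower left corner (x, y) and sides L / 2^n and M
    / 2^n. A bad rectangle has a bad quarter by [Hsplit]; the nested bad rectangles share a point,
    and [Hloc] at this point contradicts the badness of a deep one. *)
Lemma bisection : good a c 0.
Proof.
  apply NNPP. intros Hbad.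
  (* The assumption on p stands below the existential, so that choice yields a total successor
     function; a p that is not bad is sent to itself. *)
  assert (Hch : forall n p, exists q, inside p n /\ ~ good (fst p) (snd p) n ->
     inside q (S n) /\ ~ good (fst q) (snd q) (S n) /\
    fst p <= fst q /\ fst q + l (S n) <= fst p + l n /\
    snd p <= snd q /\ snd q + m (S n) <= snd p + m n).
  { intros n p. destruct (classic (inside p n /\ ~ good (fst p) (snd p) n)) as [[H1 H2]|H].
    - destruct (bad_child n p H1 H2) as [q Hq]. now exists q.
    - exists p. tauto. }
  set (next := fun n p => proj1_sig (constructive_indefinite_description _ (Hch n p))).
  set (s := fix s n := match n with O => (a, c) | S k => next k (s k) end).
  assert (Hs : forall n, inside (s n) n /\ ~ good (fst (s n)) (snd (s n)) n).
  { induction n as [|n IH].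
    - split; [|exact Hbad]. unfold inside, l, m. simpl. lra.
    - pose proof (proj2_sig (constructive_indefinite_description _ (Hch n (s n))) IH) as H.
      split; apply H. }
  assert (Hn : forall n, fst (s n) <= fst (s (S n)) /\ fst (s (S n)) + l (S n) <= fst (s n) + l n /\
    snd (s n) <= snd (s (S n)) /\ snd (s (S n)) + m (S n) <= snd (s n) + m n).
  { intros n. pose proof (proj2_sig (constructive_indefinite_description _ (Hch n (s n))) (Hs n)) as H.
    apply H. }
  assert (Hm : forall n k, fst (s n) <= fst (s (n + k)%nat) /\
    fst (s (n + k)%nat) + l (n + k)%nat <= fst (s n) + l n /\
    snd (s n) <= snd (s (n + k)%nat) /\ snd (s (n + k)%nat) + m (n + k)%nat <= snd (s n) + m n).
  { intros n. induction k as [|k IH].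
    - rewrite Nat.add_0_r. lra.
    - rewrite Nat.add_succ_r. pose proof (Hn (n + k)%nat). lra. }
  assert (Hm2 : forall i j, fst (s i) <= fst (s j) + l j /\ snd (s i) <= snd (s j) + m j).
  { intros i j. destruct (Nat.le_ge_cases i j) as [H|H].
    - pose proof (Hm i (j - i)%nat) as H1. replace (i + (j - i))%nat with j in H1 by lia.
      pose proof (l_pos j). pose proof (m_pos j). lra.
    - pose proof (Hm j (i - j)%nat) as H1. replace (j + (i - j))%nat with i in H1 by lia.
      pose proof (l_pos i). pose proof (m_pos i). lra. }
  (* Every lower end lies below every upper end, so the supremum of the lower ends belongs to all
     the intervals. *)
  assert (Hlub : forall f w : nat -> R, (forall i j, f i <= f j + w j) ->
    exists u, forall n, f n <= u <= f n + w n).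
  { intros f w Hf.
    destruct (completeness (fun x => exists n, x = f n)) as [u [Hu1 Hu2]].
    - exists (f O + w O). intros x [n ->]. apply Hf.
    - now exists (f O), O.
    - exists u. intros n. split; [apply Hu1; now exists n|].
      apply Hu2. intros x [i ->]. apply Hf. }
  destruct (Hlub (fun n => fst (s n)) l (fun i j => proj1 (Hm2 i j))) as [u Hu].
  destruct (Hlub (fun n => snd (s n)) m (fun i j => proj2 (Hm2 i j))) as [v Hv].
  destruct (Hloc u v) as [N HN].
  - pose proof (Hu O). unfold l in H. simpl in H. lra.
  - pose proof (Hv O). unfold m in H. simpl in H. lra.
  - destruct (Hs N) as [Hi Hg]. apply Hg. destruct Hi as (H1 & H2 & H3 & H4).
    now apply HN.
Qed.
End Bisection.

Lemma Cmod_pt_le x y : Cmod (RtoC x + Ci * RtoC y)%C <= Rabs x + Rabs y.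
Proof.
  eapply Rle_trans; [apply Cmod_triangle|]. rewrite Cmod_mult, Cmod_Ci, !Cmod_R. lra.
Qed.

Lemma crect_sub G a b c d a' b' c' d' : crect G a b c d -> a <= a' -> b' <= b -> c <= c' -> d' <= d ->
  crect G a' b' c' d'.
Proof. intros H ? ? ? ? x y Hx Hy. apply H; lra. Qed.

(** The affine part of [G] at p has a quadratic primitive and integrates to 0. The remainder is at
    most e (h + k) on a boundary of length 2 (h + k). *)
Lemma Goursat_local G p l e : 0 < e -> cder G p l -> exists del, 0 < del /\
  forall x y h k, 0 <= h -> 0 <= k -> h + k < del -> crect G x (x + h) y (y + k) ->
  x <= fst p <= x + h -> y <= snd p <= y + k ->
  Cmod (rect_int G x (x + h) y (y + k)) <= 2 * e * (h + k) ^ 2.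
Proof.
  intros He Hl. destruct (Hl e He) as [d [Hd Hw]]. exists d. split; [easy|].
  intros x y h k Hh Hk Hhk HG Hx Hy.
  set (T := fun w => (G p + l * (w - p))%C).
  assert (HT : forall z, ccont T z).
  { intros z. apply ccont_plus; [apply ccont_const|]. apply ccont_mult; [apply ccont_const|].
    apply ccont_minus; [apply ccont_id|apply ccont_const]. }
  assert (HT0 : rect_int T x (x + h) y (y + k) = 0).
  { apply (rect_int_primitive (fun w => G p * w + l * / 2 * ((w - p) * (w - p)))%C); try lra.
    - intros ? ? ? ?. apply HT.
    - intros z. unfold T.
      (* The affine function in the shape that the sum and product rules produce. *)
      replace (G p + l * (z - p))%C with
       ((0 * z + G p * 1) + (0 * ((z - p) * (z - p)) + l * / 2 * ((1 - 0) * (z - p) + (z - p) * (1 - 0))))%C.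
      2: { field. }
      assert (Hzp : cder (fun w => w - p)%C z (1 - 0)).
      { apply cder_minus; [apply cder_id|apply cder_const]. }
      apply cder_plus.
      + apply (cder_mult (fun _ => G p) (fun w => w)); [apply cder_const|apply cder_id].
      + apply (cder_mult (fun _ => l * / 2)%C (fun w => (w - p) * (w - p))%C); [apply cder_const|].
        now apply (cder_mult (fun w => w - p)%C (fun w => w - p)%C). }
  replace (rect_int G x (x + h) y (y + k)) with (rect_int (fun w => G w - T w)%C x (x + h) y (y + k)).
  2: { rewrite rect_int_minus; try lra; auto.
       - rewrite HT0. ring.
       - intros ? ? ? ?; apply HT. }
  replace (2 * e * (h + k) ^ 2) with (2 * ((x + h - x) + (y + k - y)) * (e * (h + k))) by ring.
  apply rect_int_le; try lra.
  - intros x' y' Hx' Hy'. apply ccont_minus; [apply HG; lra|apply HT].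
  - intros x' y' Hx' Hy'. set (w := (x' + Ci * y')%C).
    assert (Hwp : Cmod (w - p) <= h + k).
    { destruct p as [u v]. simpl in Hx, Hy.
      replace (w - (u, v))%C with (RtoC (x' - u) + Ci * RtoC (y' - v))%C.
      2: { unfold w. apply injective_projections; simpl; ring. }
      eapply Rle_trans; [apply Cmod_pt_le|].
      apply Rplus_le_compat; apply Rabs_le; lra. }
    unfold T. replace (G w - (G p + l * (w - p)))%C with (G w - G p - l * (w - p))%C by ring.
    eapply Rle_trans; [apply Hw; lra|]. apply Rmult_le_compat_l; lra.
Qed.

(** The bound e / 4^n adds up over four quarters, and at depth n the local estimate is quadratic in
    sides of order 2^-n, hence also of order 4^-n. Bisection therefore works for every e > 0. *)
Theorem Goursat G a b c d : a <= b -> c <= d ->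
  (forall x y, a <= x <= b -> c <= y <= d -> cdif G (RtoC x + Ci * RtoC y)) ->
  rect_int G a b c d = 0.
Proof.
  intros Hab Hcd HG.
  assert (HC : crect G a b c d) by (intros x y Hx Hy; now apply cdif_ccont, HG).
  set (L := b - a). set (M := d - c).
  assert (Hsmall : forall e, 0 < e -> Cmod (rect_int G a b c d) <= e).
  { intros e He.
    set (good := fun x y n => Cmod (rect_int G x (x + L / 2 ^ n) y (y + M / 2 ^ n)) <= e / 4 ^ n).
    assert (Hg : good a c O).
    { apply (bisection a c L M good); try (unfold L, M; lra).
      - intros x y n Hx Hx' Hy Hy' H1 H2 H3 H4.
        assert (0 <= L / 2 ^ S n) by (apply Rdiv_le_0_compat; [unfold L; lra|apply pow_lt; lra]).
        assert (0 <= M / 2 ^ S n) by (apply Rdiv_le_0_compat; [unfold M; lra|apply pow_lt; lra]).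
        unfold good in *.
        assert (E1 := halves L n). assert (E2 := halves M n).
        assert (HC' : crect G x (x + L / 2 ^ n) y (y + M / 2 ^ n)).
        { apply (crect_sub _ _ _ _ _ _ _ _ _ HC); unfold L, M in *; lra. }
        rewrite E1, E2 in *.
        set (h := L / 2 ^ S n) in *. set (k := M / 2 ^ S n) in *.
        rewrite (rect_int_split_h _ _ (x + h)), (rect_int_split_v _ x _ _ (y + k)),
          (rect_int_split_v _ (x + h) _ _ (y + k)); try lra; auto;
          try (apply (crect_sub _ _ _ _ _ _ _ _ _ HC'); lra).
        replace (x + h + h) with (x + 2 * h) in * by ring.
        replace (y + k + k) with (y + 2 * k) in * by ring.
        assert (E4 : e / 4 ^ n = 4 * (e / 4 ^ S n)).
        { simpl. field. apply pow_nonzero; lra. }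
        rewrite E4.
        eapply Rle_trans; [apply Cmod_triangle|].
        pose proof (Cmod_triangle (rect_int G x (x + h) y (y + k)) (rect_int G x (x + h) (y + k) (y + 2 * k))).
        pose proof (Cmod_triangle (rect_int G (x + h) (x + 2 * h) y (y + k)) (rect_int G (x + h) (x + 2 * h) (y + k) (y + 2 * k))).
        lra.
      - intros u v Hu Hv.
        destruct (HG u v) as [l Hl]; [unfold L, M in *; lra..|].
        set (K := L + M). assert (HK : 0 <= K) by (unfold K, L, M; lra).
        (* With half perimeter K / 2^n this tolerance gives e / 4^n times K^2 / (K^2 + 1); the added
           1 keeps the denominator positive for a degenerate rectangle. *)
        destruct (Goursat_local G (u + Ci * v)%C l (e / (2 * (K * K + 1)))) with (2 := Hl) as [del [Hdel Hb]].
        { apply Rdiv_lt_0_compat; nra. }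
        destruct (half_pow_small K del HK Hdel) as [N HN].
        exists N. intros n x y Hn Hx Hx' Hy Hy' Hxu Hyv.
        assert (Hp2 : 0 < 2 ^ n) by (apply pow_lt; lra).
        assert (Hp4 : 4 ^ n = 2 ^ n * 2 ^ n) by (rewrite <- Rpow_mult_distr; f_equal; lra).
        assert (EK : L / 2 ^ n + M / 2 ^ n = K / 2 ^ n) by (unfold K; field; lra).
        unfold good. eapply Rle_trans; [apply Hb|].
        + apply Rdiv_le_0_compat; [unfold L; lra|easy].
        + apply Rdiv_le_0_compat; [unfold M; lra|easy].
        + rewrite EK. now apply HN.
        + apply (crect_sub _ _ _ _ _ _ _ _ _ HC); unfold L, M in *; lra.
        + simpl; lra.
        + simpl; lra.
        + rewrite EK, Hp4.
          replace (2 * (e / (2 * (K * K + 1))) * (K / 2 ^ n) ^ 2)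
            with (e / (2 ^ n * 2 ^ n) * (K * K / (K * K + 1))) by (field; split; nra).
          rewrite <- (Rmult_1_r (e / (2 ^ n * 2 ^ n))) at 2.
          apply Rmult_le_compat_l.
          * apply Rdiv_le_0_compat; [lra|]. now apply Rmult_lt_0_compat.
          * apply Rle_div_l; nra. }
    unfold good in Hg. simpl in Hg. rewrite !Rdiv_1_r in Hg. unfold L, M in Hg.
    replace (a + (b - a)) with b in Hg by ring. replace (c + (d - c)) with d in Hg by ring.
    exact Hg. }
  apply Cmod_eq_0. apply Rle_antisym; [|apply Cmod_ge_0].
  apply le_epsilon. intros e He. rewrite Rplus_0_l. now apply Hsmall.
Qed.

(** * Cauchy's formula on a disc *)

Lemma exp_le_mono x y : x <= y -> exp x <= exp y.
Proof. intros [H| ->]; [now apply Rlt_le, exp_increasing|lra]. Qed.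

Definition cexp (z : C) : C := (exp (fst z) * cos (snd z), exp (fst z) * sin (snd z)).

Lemma cexp_add z w : cexp (z + w) = (cexp z * cexp w)%C.
Proof.
  destruct z as [a b], w as [c d]. unfold cexp. simpl.
  rewrite exp_plus, cos_plus, sin_plus. apply injective_projections; simpl; ring.
Qed.

Lemma cexp_RtoC x : cexp (RtoC x) = RtoC (exp x).
Proof. unfold cexp. simpl. rewrite cos_0, sin_0. apply injective_projections; simpl; ring. Qed.

Lemma Cmod_cexp z : Cmod (cexp z) = exp (fst z).
Proof.
  unfold cexp, Cmod. simpl.
  replace (_ + _) with ((exp (fst z)) ^ 2 * (Rsqr (sin (snd z)) + Rsqr (cos (snd z)))) by (unfold Rsqr; ring).
  rewrite sin2_cos2, Rmult_1_r. apply sqrt_pow2, Rlt_le, exp_pos.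
Qed.

Lemma Cmod_cexp_Ci t : Cmod (cexp (Ci * RtoC t)) = 1.
Proof. rewrite Cmod_cexp. simpl. rewrite <- exp_0. f_equal. ring. Qed.

Lemma derivable_pt_lim_0 f l e : derivable_pt_lim f 0 l -> 0 < e ->
  exists d, 0 < d /\ forall h, Rabs h < d -> Rabs (f h - f 0 - l * h) <= e * Rabs h.
Proof.
  intros H He. destruct (H e He) as [d Hd]. exists d. split; [apply cond_pos|].
  intros h Hh. destruct (Req_dec h 0) as [->|H0].
  - replace (f 0 - f 0 - l * 0) with 0 by ring. rewrite Rabs_R0. lra.
  - specialize (Hd h H0 Hh). rewrite Rplus_0_l in Hd.
    replace (f h - f 0 - l * h) with (((f h - f 0) / h - l) * h) by now field.
    rewrite Rabs_mult. apply Rmult_le_compat_r; [apply Rabs_pos|lra].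
Qed.

Lemma cexp_0_expand e : 0 < e -> exists d, 0 < d /\ forall h, Cmod h < d ->
  Cmod (cexp h - 1 - h) <= e * Cmod h.
Proof.
  (* The remainders of [exp], [cos], [sin] and the mixed term add up to 1 + 2 + 2 + 1 = 6 multiples
     of m |h|. Taking |x| < m / 2 gives |exp x - 1| <= m, and m <= 1/2 then gives exp x <= 2. *)
  intros He. set (m := Rmin (e / 6) (1 / 2)).
  assert (Hm : 0 < m) by (apply Rmin_glb_lt; lra).
  assert (Hm1 : m <= e / 6) by apply Rmin_l. assert (Hm2 : m <= 1 / 2) by apply Rmin_r.
  destruct (derivable_pt_lim_0 exp 1 m) as [d1 [Hd1 H1]]; auto.
  { pose proof (derivable_pt_lim_exp 0) as D. now rewrite exp_0 in D. }
  destruct (derivable_pt_lim_0 cos 0 m) as [d2 [Hd2 H2]]; auto.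
  { pose proof (derivable_pt_lim_cos 0) as D. now rewrite sin_0, Ropp_0 in D. }
  destruct (derivable_pt_lim_0 sin 1 m) as [d3 [Hd3 H3]]; auto.
  { pose proof (derivable_pt_lim_sin 0) as D. now rewrite cos_0 in D. }
  exists (Rmin (Rmin d1 d2) (Rmin d3 (m / 2))). split.
  { repeat apply Rmin_glb_lt; lra. }
  intros h Hh.
  assert (Hx : Rabs (fst h) <= Cmod h) by (eapply Rle_trans; [apply Rmax_l|apply Rmax_Cmod]).
  assert (Hy : Rabs (snd h) <= Cmod h) by (eapply Rle_trans; [apply Rmax_r|apply Rmax_Cmod]).
  destruct h as [x y]. simpl fst in *; simpl snd in *.
  apply Rmin_Rgt in Hh. destruct Hh as [Ha Hb]. apply Rmin_Rgt in Ha. apply Rmin_Rgt in Hb.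
  specialize (H1 x ltac:(lra)). specialize (H2 y ltac:(lra)). specialize (H3 y ltac:(lra)).
  rewrite exp_0 in H1. rewrite cos_0 in H2. rewrite sin_0 in H3.
  replace (cexp (x, y) - 1 - (x, y))%C with
    (RtoC ((exp x - 1 - 1 * x) + exp x * (cos y - 1 - 0 * y)) +
     Ci * RtoC (exp x * (sin y - 0 - 1 * y) + (exp x - 1) * y))%C.
  2: { unfold cexp. apply injective_projections; simpl; ring. }
  eapply Rle_trans; [apply Cmod_pt_le|].
  assert (He1 : Rabs (exp x - 1) <= 2 * Rabs x).
  { replace (exp x - 1) with ((exp x - 1 - 1 * x) + x) by ring.
    eapply Rle_trans; [apply Rabs_triang|]. pose proof (Rabs_pos x). nra. }
  assert (He2 : exp x <= 2).
  { pose proof (Rle_abs (exp x - 1)). lra. }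
  pose proof (exp_pos x).
  pose proof (Rabs_triang (exp x - 1 - 1 * x) (exp x * (cos y - 1 - 0 * y))) as T1.
  pose proof (Rabs_triang (exp x * (sin y - 0 - 1 * y)) ((exp x - 1) * y)) as T2.
  rewrite !Rabs_mult, (Rabs_pos_eq (exp x)) in * by lra.
  pose proof (Rabs_pos x). pose proof (Rabs_pos y).
  pose proof (Rabs_pos (cos y - 1 - 0 * y)). pose proof (Rabs_pos (sin y - 0 - 1 * y)).
  pose proof (Cmod_ge_0 (x, y)).
  assert (exp x * Rabs (cos y - 1 - 0 * y) <= 2 * (m * Rabs y)) by (apply Rmult_le_compat; lra).
  assert (exp x * Rabs (sin y - 0 - 1 * y) <= 2 * (m * Rabs y)) by (apply Rmult_le_compat; lra).
  assert (Rabs (exp x - 1) * Rabs y <= m * Rabs y) by (apply Rmult_le_compat_r; lra).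
  assert (m * Rabs x <= e / 6 * Cmod (x, y)) by (apply Rmult_le_compat; lra).
  assert (m * Rabs y <= e / 6 * Cmod (x, y)) by (apply Rmult_le_compat; lra).
  lra.
Qed.

Lemma cder_cexp z : cder cexp z (cexp z).
Proof.
  intros e He. assert (Hz : 0 < Cmod (cexp z)) by (rewrite Cmod_cexp; apply exp_pos).
  destruct (cexp_0_expand (e / Cmod (cexp z))) as [d [Hd H]]; [now apply Rdiv_lt_0_compat|].
  exists d. split; [easy|]. intros w Hw. specialize (H _ Hw).
  replace w with (z + (w - z))%C at 1 by ring. rewrite cexp_add.
  replace (cexp z * cexp (w - z) - cexp z - cexp z * (w - z))%C
    with (cexp z * (cexp (w - z) - 1 - (w - z)))%C by ring.
  rewrite Cmod_mult. apply Rle_trans with (Cmod (cexp z) * (e / Cmod (cexp z) * Cmod (w - z))).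
  - apply Rmult_le_compat_l; lra.
  - right. field. lra.
Qed.

(** * Integrals over circles *)

Definition circ (r : R) (w : C) : C := (RtoC r * cexp (Ci * w))%C.

(** The integral is in dt, not dw. As dw = i w dt, the Cauchy kernel takes the form w / (w - z), and
    radius 0 makes sense, with value 2 PI g(0). *)
Definition circ_int (g : C -> C) (r : R) : C := cint (fun w => g (circ r w)) 0 (2 * PI).

Lemma cdif_circ r z : cdif (circ r) z.
Proof.
  apply cdif_mult; [apply cdif_const|]. apply (cdif_comp cexp); [eexists; apply cder_cexp|].
  apply cdif_mult; [apply cdif_const|apply cdif_id].
Qed.

Lemma Cmod_circ r t : 0 <= r -> Cmod (circ r (RtoC t)) = r.
Proof. intros Hr. unfold circ. rewrite Cmod_mult, Cmod_cexp_Ci, Cmod_R, Rabs_pos_eq; lra. Qed.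

Lemma two_PI_pos : 0 <= 2 * PI.
Proof. pose proof PI_RGT_0. lra. Qed.

Lemma cseg_circ g r a b : 0 <= r -> (forall w, Cmod w = r -> ccont g w) -> cseg (fun w => g (circ r w)) a b.
Proof.
  intros Hr H t _. apply (ccont_comp g (circ r)).
  - apply cdif_ccont, cdif_circ.
  - apply H. now apply Cmod_circ.
Qed.

(* Goursat for [g o cexp] on a rectangle of height [2 * PI]: the horizontal sides cancel. *)
Lemma circ_int_annulus g r s : 0 < r <= s ->
  (forall w, r <= Cmod w <= s -> cdif g w) -> circ_int g r = circ_int g s.
Proof.
  intros Hr Hg. pose proof PI_RGT_0.
  assert (Hln : ln r <= ln s) by (apply ln_le; lra).
  assert (HG := Goursat (fun z => g (cexp z)) (ln r) (ln s) 0 (2 * PI) Hln two_PI_pos).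
  assert (H0 : rect_int (fun z => g (cexp z)) (ln r) (ln s) 0 (2 * PI) = 0).
  { apply HG. intros x y Hx Hy. apply (cdif_comp g cexp); [|eexists; apply cder_cexp].
    apply Hg. rewrite Cmod_cexp. simpl. replace (x + _) with x by ring.
    rewrite <- (exp_ln r), <- (exp_ln s) by lra.
    split; apply exp_le_mono; lra. }
  unfold rect_int in H0.
  assert (Hc : forall x, 0 < x ->
    cint (fun w => g (cexp (ln x + Ci * w))) 0 (2 * PI) = circ_int g x).
  { intros x Hx. apply cint_ext; [lra|]. intros t _. unfold circ.
    now rewrite cexp_add, cexp_RtoC, exp_ln. }
  rewrite !Hc in H0 by lra.
  rewrite (cint_ext (fun w => g (cexp (w + Ci * (2 * PI)%R))) (fun w => g (cexp (w + Ci * 0)))) in H0; auto.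
  2: { intros t _. f_equal. rewrite !cexp_add. f_equal. unfold cexp. simpl.
       replace (0 * 0 - 1 * 0) with 0 by ring.
       replace (0 * (2 * PI) - 1 * 0) with 0 by ring.
       replace (0 * 0 + 1 * (2 * PI)) with (2 * PI) by ring.
       replace (0 * 0 + 1 * 0) with 0 by ring.
       now rewrite cos_2PI, sin_2PI, cos_0, sin_0. }
  assert (H1 : (Ci * (circ_int g s - circ_int g r) = 0)%C) by (rewrite <- H0; ring).
  assert (H2 : (circ_int g s - circ_int g r = 0)%C).
  { replace (circ_int g s - circ_int g r)%C with (- Ci * (Ci * (circ_int g s - circ_int g r)))%C.
    - rewrite H1. ring.
    - apply injective_projections; simpl; ring. }
  symmetry. now apply Ceq_minus.
Qed.

(** Compactness of [a, b], with one number d serving both as the radius of the neighbourhood and as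
    the parameter of the property; a smaller d weakens the property. *)
Lemma interval_uniform (P : R -> R -> Prop) a b :
  (forall d d' t, d' <= d -> P d t -> P d' t) ->
  (forall t, a <= t <= b -> exists d, 0 < d /\ forall s, a <= s <= b -> Rabs (s - t) < d -> P d s) ->
  exists d, 0 < d /\ forall s, a <= s <= b -> P d s.
Proof.
  intros Hmon Hloc.
  (* The gauge must be defined on all of R; outside [a, b] it takes the dummy value 1. *)
  assert (Hch : forall t, exists d : posreal, a <= t <= b ->
    forall s, a <= s <= b -> Rabs (s - t) < d -> P d s).
  { intros t. destruct (classic (a <= t <= b)) as [Ht|Ht].
    - destruct (Hloc t Ht) as [d [Hd H]]. exists (mkposreal d Hd). intros _. exact H.
    - exists (mkposreal 1 Rlt_0_1). tauto. }
  destruct (compactness_value_1d a b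
    (fun t => proj1_sig (constructive_indefinite_description _ (Hch t)))) as [d Hd].
  exists d. split; [apply cond_pos|]. intros s Hs.
  apply NNPP. intros Hn. apply (Hd s Hs). intros [t (Ht & Hst & Hdt)]. apply Hn.
  apply (Hmon _ _ _ Hdt).
  exact (proj2_sig (constructive_indefinite_description _ (Hch t)) Ht s Hs Hst).
Qed.

(** Continuity of [g] is made uniform along the circle of radius [r0]. The value [r0 = 0] is
    included, so that circles may shrink to a point. *)
Lemma circ_int_continuous g r0 R0 e : 0 <= r0 < R0 -> 0 < e ->
  (forall w, Cmod w < R0 -> ccont g w) ->
  exists d, 0 < d /\ forall r, 0 <= r < R0 -> Rabs (r - r0) < d ->
    Cmod (circ_int g r - circ_int g r0) <= e.
Proof.
  intros Hr0 He Hg. pose proof PI_RGT_0. set (e' := e / (2 * PI)).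
  assert (He' : 0 < e') by (apply Rdiv_lt_0_compat; lra).
  destruct (interval_uniform (fun d t => forall r, 0 <= r < R0 -> Rabs (r - r0) < d ->
     Cmod (g (circ r (RtoC t)) - g (circ r0 (RtoC t))) <= e') 0 (2 * PI)) as [d [Hd Hu]].
  - intros d d' t Hdd Hp r Hr Hd. apply Hp; lra.
  - intros t Ht. destruct (Hg (circ r0 (RtoC t))) with (eps := e' / 2) as [eta [Heta Hgc]]; [|lra|].
    { rewrite Cmod_circ; lra. }
    destruct (cdif_ccont _ _ (cdif_circ r0 (RtoC t)) (eta / 2)) as [d [Hd Hc]]; [lra|].
    exists (Rmin d (eta / 2)). split; [apply Rmin_glb_lt; lra|].
    intros s Hs Hst r Hr Hrr. apply Rmin_Rgt in Hst. apply Rmin_Rgt in Hrr.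
    assert (H1 : Cmod (circ r0 (RtoC s) - circ r0 (RtoC t)) < eta / 2).
    { apply Hc. rewrite Cmod_RtoC_minus. lra. }
    assert (H2 : Cmod (circ r (RtoC s) - circ r0 (RtoC s)) < eta / 2).
    { unfold circ. replace (r * cexp (Ci * s) - r0 * cexp (Ci * s))%C
        with ((r - r0) * cexp (Ci * s))%C by ring.
      rewrite Cmod_mult, Cmod_cexp_Ci, Cmod_RtoC_minus. lra. }
    assert (H3 : Cmod (g (circ r s) - g (circ r0 t)) < e' / 2).
    { apply Hgc. replace (circ r s - circ r0 t)%C
        with ((circ r s - circ r0 s) + (circ r0 s - circ r0 t))%C by ring.
      eapply Rle_lt_trans; [apply Cmod_triangle|]. lra. }
    assert (H4 : Cmod (g (circ r0 s) - g (circ r0 t)) < e' / 2) by (apply Hgc; lra).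
    replace (g (circ r s) - g (circ r0 s))%C
      with ((g (circ r s) - g (circ r0 t)) + - (g (circ r0 s) - g (circ r0 t)))%C by ring.
    eapply Rle_trans; [apply Cmod_triangle|]. rewrite Cmod_opp. lra.
  - exists d. split; [easy|]. intros r Hr Hd'.
    assert (Hs : forall x, 0 <= x < R0 -> cseg (fun w => g (circ x w)) 0 (2 * PI)).
    { intros x Hx. apply cseg_circ; [lra|]. intros w Hw. apply Hg. lra. }
    unfold circ_int. rewrite <- cint_minus; auto; [|lra].
    replace e with ((2 * PI - 0) * e') by (unfold e'; field; lra).
    apply (cint_le_const (fun w => g (circ r w) - g (circ r0 w))%C); [lra| |auto].
    apply cseg_minus; auto.
Qed.

(** The circle integral is constant on radii in (0, |p|) and on radii beyond |p|, by the annulus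
    argument. Continuity in the radius joins the two ranges across |p| and extends the first down to
    0. *)
Lemma circ_int_removable g p R0 r : 0 <= r < R0 ->
  (forall w, Cmod w < R0 -> ccont g w) ->
  (forall w, Cmod w < R0 -> w <> p -> cdif g w) ->
  circ_int g r = circ_int g 0.
Proof.
  intros Hr Hc Hd.
  assert (Hlim : forall K r0, 0 <= r0 < R0 ->
    (forall d, 0 < d -> exists s, 0 <= s < R0 /\ Rabs (s - r0) < d /\ circ_int g s = K) ->
    circ_int g r0 = K).
  { intros K r0 Hr0 H. apply Ceq_minus, Cmod_eq_0. apply Rle_antisym; [|apply Cmod_ge_0].
    apply le_epsilon. intros e He. rewrite Rplus_0_l.
    destruct (circ_int_continuous g r0 R0 e Hr0 He Hc) as [d [Hd0 H1]].
    destruct (H d Hd0) as [s (Hs & Hsd & <-)]. rewrite Cmod_minus_sym. now apply H1. }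
  assert (Hmix : forall s t, 0 < s <= t -> t < R0 -> (t < Cmod p \/ Cmod p < s) ->
     circ_int g s = circ_int g t).
  { intros s t Hst Ht Hp. apply circ_int_annulus; auto. intros w Hw. apply Hd; [lra|].
    intros ->. lra. }
  assert (Hbelow : forall s, 0 <= s < R0 -> s < Cmod p -> circ_int g s = circ_int g 0).
  { intros s Hs Hsp. destruct (Req_dec s 0) as [->|H0]; [easy|].
    symmetry. apply Hlim; [lra|]. intros d Hd0. exists (Rmin s (d / 2)).
    assert (0 < Rmin s (d / 2)) by (apply Rmin_glb_lt; lra).
    pose proof (Rmin_l s (d / 2)). pose proof (Rmin_r s (d / 2)).
    split; [lra|]. split; [rewrite Rabs_pos_eq; lra|]. apply Hmix; lra. }
  assert (Hat : Cmod p < R0 -> circ_int g (Cmod p) = circ_int g 0).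
  { intros Hp. pose proof (Cmod_ge_0 p). destruct (Req_dec (Cmod p) 0) as [->|H0]; [easy|].
    apply Hlim; [lra|]. intros d Hd0. exists (Rmax 0 (Cmod p - d / 2)).
    assert (Rmax 0 (Cmod p - d / 2) < Cmod p) by (apply Rmax_lub_lt; lra).
    pose proof (Rmax_l 0 (Cmod p - d / 2)). pose proof (Rmax_r 0 (Cmod p - d / 2)).
    split; [lra|]. split; [rewrite Rabs_left; lra|]. apply Hbelow; lra. }
  destruct (Rtotal_order r (Cmod p)) as [H|[->|H]]; [now apply Hbelow|apply Hat; lra|].
  rewrite <- Hat by lra. pose proof (Cmod_ge_0 p). symmetry.
  apply Hlim; [lra|]. intros d Hd0. exists (Rmin r (Cmod p + d / 2)).
  assert (Cmod p < Rmin r (Cmod p + d / 2)) by (apply Rmin_glb_lt; lra).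
  pose proof (Rmin_l r (Cmod p + d / 2)). pose proof (Rmin_r r (Cmod p + d / 2)).
  split; [lra|]. split; [rewrite Rabs_pos_eq; lra|]. apply Hmix; lra.
Qed.

(** The value does not depend on the radius beyond |z|, and for large radii the kernel tends to 1
    uniformly. *)
Lemma circ_int_kernel z r : Cmod z < r -> circ_int (fun w => w * / (w - z))%C r = RtoC (2 * PI).
Proof.
  intros Hz. pose proof PI_RGT_0. pose proof (Cmod_ge_0 z).
  assert (Hd : forall w, Cmod z < Cmod w -> cdif (fun w => w * / (w - z))%C w).
  { intros w Hw. apply cdif_Cauchy_kernel. intros ->. lra. }
  apply Ceq_minus, Cmod_eq_0. apply Rle_antisym; [|apply Cmod_ge_0].
  apply le_epsilon. intros e He. rewrite Rplus_0_l.
  (* On radius s the kernel differs from 1 by at most |z| / (s - |z|), and this choice makes 2 PI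
     times that at most e. *)
  set (s := Rmax r (Cmod z + 2 * PI * Cmod z / e + 1)).
  assert (Hs1 : r <= s) by apply Rmax_l.
  assert (Hs2 : Cmod z + 2 * PI * Cmod z / e + 1 <= s) by apply Rmax_r.
  assert (0 <= 2 * PI * Cmod z / e).
  { apply Rdiv_le_0_compat; [|easy]. apply Rmult_le_pos; lra. }
  rewrite (circ_int_annulus _ r s) by (lra || (intros; apply Hd; lra)).
  replace (RtoC (2 * PI)) with (cint (fun _ => RtoC 1) 0 (2 * PI)).
  2: { rewrite cint_const, <- RtoC_mult. f_equal. ring. }
  assert (Hseg : cseg (fun w => circ s w * / (circ s w - z))%C 0 (2 * PI)).
  { apply (cseg_circ (fun w => w * / (w - z))%C); [lra|]. intros w Hw. apply cdif_ccont, Hd. lra. }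
  unfold circ_int. rewrite <- cint_minus; [|lra|easy|intros ? _; apply ccont_const].
  apply Rle_trans with ((2 * PI - 0) * (Cmod z / (s - Cmod z))).
  - apply (cint_le_const (fun w => circ s w * / (circ s w - z) - 1)%C); [lra| |].
    + apply cseg_minus; [easy|]. intros ? _. apply ccont_const.
    + intros t _. assert (Hm := Cmod_circ s t ltac:(lra)). set (w := circ s t) in *.
      assert (Hwz : s - Cmod z <= Cmod (w - z)) by (rewrite <- Hm; apply Cmod_triangle_rev).
      assert (w - z <> 0)%C by (apply <- Cmod_gt_0; lra).
      replace (w * / (w - z) - 1)%C with (z / (w - z))%C by now field.
      rewrite Cmod_div by easy. apply Rmult_le_compat_l; [easy|].
      apply Rinv_le_contravar; lra.
  - rewrite Rminus_0_r. unfold Rdiv. rewrite <- Rmult_assoc. apply Rle_div_l; [lra|].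
    assert (2 * PI * Cmod z / e <= s - Cmod z) by lra.
    apply Rle_div_l in H2; [|easy]. lra.
Qed.

(* The difference quotient of [f] at [z], extended by [f'(z)], has a removable singularity,
   so its integral against [w] over the circle equals the one at radius [0]. *)
Theorem Cauchy_formula f R0 r z : Cmod z < r < R0 -> (forall w, Cmod w < R0 -> cdif f w) ->
  circ_int (fun w => f w * (w * / (w - z)))%C r = (RtoC (2 * PI) * f z)%C.
Proof.
  intros Hr Hf. pose proof PI_RGT_0. pose proof (Cmod_ge_0 z).
  destruct (Hf z) as [l Hl]; [lra|].
  set (q := fun w => if Ceq_dec w z then l else ((f w - f z) * / (w - z))%C).
  assert (Hqd : forall w, Cmod w < R0 -> w <> z -> cdif q w).
  { intros w Hw Hwz.
    assert (0 < Cmod (w - z)) by (apply -> Cmod_gt_0; intros E; now apply Ceq_minus in E).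
    apply (cdif_ext_loc (fun w => (f w - f z) * / (w - z))%C _ _ (Cmod (w - z))); auto.
    - intros v Hv. unfold q. destruct (Ceq_dec v z) as [->|]; [|easy].
      rewrite Cmod_minus_sym in Hv. lra.
    - apply cdif_mult; [apply cdif_minus; [auto|apply cdif_const]|].
      now apply cdif_inv_sub. }
  assert (Hqc : forall w, Cmod w < R0 -> ccont q w).
  { intros w Hw. destruct (Ceq_dec w z) as [->|Hwz]; [|now apply cdif_ccont, Hqd].
    intros e He. destruct (Hl (e / 2)) as [d [Hd H1]]; [lra|].
    exists d. split; [easy|]. intros v Hv. specialize (H1 v Hv). unfold q.
    destruct (Ceq_dec z z) as [_|]; [|easy].
    destruct (Ceq_dec v z) as [->|Hvz].
    - replace (l - l)%C with (RtoC 0) by ring. now rewrite Cmod_0.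
    - assert (v - z <> 0)%C by (intros E; now apply Ceq_minus in E).
      replace ((f v - f z) * / (v - z) - l)%C with ((f v - f z - l * (v - z)) / (v - z))%C by now field.
      rewrite Cmod_div by easy. assert (0 < Cmod (v - z)) by now apply -> Cmod_gt_0.
      apply Rle_lt_trans with (e / 2); [|lra]. now apply Rle_div_l. }
  assert (H1 : circ_int (fun w => w * q w)%C r = 0).
  { rewrite (circ_int_removable _ z R0) by
     (lra || (intros; apply ccont_mult; [apply ccont_id|auto]) || (intros; apply cdif_mult; [apply cdif_id|auto])).
    unfold circ_int. rewrite (cint_ext _ (fun _ => 0)), cint_const; [ring|lra|].
    intros t _. unfold circ. ring. }
  assert (Hk : forall w, Cmod w = r -> cdif (fun w => w * / (w - z))%C w).
  { intros w Hw. apply cdif_Cauchy_kernel. intros ->. lra. }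
  rewrite <- (circ_int_kernel z r), Cmult_comm by lra.
  apply Ceq_minus. rewrite <- H1. unfold circ_int.
  rewrite <- (cint_scal (f z) (fun w => circ r w * / (circ r w - z))%C), <- cint_minus; try lra.
  - apply cint_ext; [lra|]. intros t _. assert (Hm := Cmod_circ r t ltac:(lra)).
    unfold q. destruct (Ceq_dec (circ r t) z) as [E|]; [rewrite E in Hm; lra|]. ring.
  - apply (cseg_circ (fun w => f w * (w * / (w - z)))%C); [lra|]. intros w Hw.
    apply ccont_mult; apply cdif_ccont; [apply Hf; lra|auto].
  - apply cseg_scal. apply (cseg_circ (fun w => w * / (w - z))%C); [lra|].
    intros w Hw. now apply cdif_ccont, Hk.
  - apply (cseg_circ (fun w => w * / (w - z))%C); [lra|].
    intros w Hw. now apply cdif_ccont, Hk.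
Qed.

(** * Unique continuation and integrals with a parameter *)

(** Writing the bound as [/ d] turns boundedness into a property that weakens as d shrinks, as
    [interval_uniform] requires. *)
Lemma cseg_bounded f a b : cseg f a b -> exists M, forall t, a <= t <= b -> Cmod (f (RtoC t)) <= M.
Proof.
  intros Hf.
  destruct (interval_uniform (fun d t => 0 < d -> Cmod (f (RtoC t)) <= / d) a b) as [d [Hd H]].
  - intros d d' t Hdd H Hd'. eapply Rle_trans; [apply H; lra|]. apply Rinv_le_contravar; lra.
  - intros t Ht. destruct (Hf t Ht 1 Rlt_0_1) as [d [Hd H]].
    pose proof (Cmod_ge_0 (f t)).
    exists (Rmin d (/ (Cmod (f t) + 1))). split.
    { apply Rmin_glb_lt; [easy|]. apply Rinv_0_lt_compat. lra. }
    intros s Hs Hst Hpos. apply Rle_trans with (Cmod (f t) + 1).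
    + assert (H1 : Cmod (f s - f t) < 1).
      { apply H. rewrite Cmod_RtoC_minus. eapply Rlt_le_trans; [apply Hst|apply Rmin_l]. }
      pose proof (Cmod_triangle_rev (f s) (f t)). lra.
    + apply Rle_trans with (/ / (Cmod (f t) + 1)); [rewrite Rinv_inv; lra|].
      apply Rinv_le_contravar; [easy|apply Rmin_r].
  - exists (/ d). auto.
Qed.

Lemma le_geom_0 x M q : 0 <= q < 1 -> (forall n, x <= M * q ^ n) -> x <= 0.
Proof.
  intros Hq H. apply le_epsilon. intros e He. rewrite Rplus_0_l.
  assert (HM : 0 < Rabs M + 1) by (pose proof (Rabs_pos M); lra).
  destruct (pow_lt_1_zero q ltac:(rewrite Rabs_pos_eq; lra) (e / (Rabs M + 1))) as [N HN].
  { now apply Rdiv_lt_0_compat. }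
  specialize (HN N (Nat.le_refl N)). rewrite Rabs_pos_eq in HN by (apply pow_le; lra).
  apply Rlt_div_r in HN; [|easy]. specialize (H N).
  assert (0 <= q ^ N) by (apply pow_le; lra). pose proof (Rle_abs M). nra.
Qed.

(* Apply Cauchy's formula to [f w / w ^ n], still holomorphic at [0], and let [n] tend to infinity. *)
Lemma vanishing_disc (f : C -> C) R0 rho z : 0 < rho -> Cmod z < R0 ->
  (forall w, Cmod w < R0 -> cdif f w) -> (forall w, Cmod w < rho -> f w = 0) -> f z = 0.
Proof.
  intros Hrho Hz Hf H0. destruct (Ceq_dec z 0) as [->|Hz0].
  { apply H0. now rewrite Cmod_0. }
  pose proof PI_RGT_0. assert (Hz1 : 0 < Cmod z) by now apply -> Cmod_gt_0.
  set (r := (Cmod z + R0) / 2). assert (Hr : Cmod z < r < R0) by (unfold r; lra).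
  assert (Hk : forall w, Cmod w = r -> cdif (fun w => w * / (w - z))%C w).
  { intros w Hw. apply cdif_Cauchy_kernel. intros ->. lra. }
  assert (Hseg : cseg (fun w => f (circ r w) * (circ r w * / (circ r w - z)))%C 0 (2 * PI)).
  { apply (cseg_circ (fun w => f w * (w * / (w - z)))%C); [lra|]. intros w Hw.
    apply cdif_ccont, cdif_mult; [apply Hf; lra|auto]. }
  destruct (cseg_bounded _ _ _ Hseg) as [M HM].
  apply Cmod_eq_0, Rle_antisym; [|apply Cmod_ge_0].
  apply (le_geom_0 _ M (Cmod z / r)).
  { split; [apply Rdiv_le_0_compat; lra|apply Rlt_div_l; lra]. }
  intros n. set (g := fun w => (f w * (/ w) ^ n)%C).
  assert (Hg : forall w, Cmod w < R0 -> cdif g w).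
  { intros w Hw. destruct (Ceq_dec w 0) as [->|Hw0].
    - apply (cdif_ext_loc (fun _ => RtoC 0) _ _ rho); [easy| |apply cdif_const].
      intros v Hv. replace (v - 0)%C with v in Hv by ring. unfold g. rewrite H0 by easy. ring.
    - apply cdif_mult; [auto|]. apply (cdif_pow (fun w => / w)%C).
      apply (cdif_inv (fun w => w)); [easy|apply cdif_id]. }
  assert (HC := Cauchy_formula g R0 r z Hr Hg).
  (* Dividing by w^n multiplies the integrand by a factor of modulus r^-n. Hence |f z| <= M (|z| /
     r)^n with the same M for all n. *)
  assert (HB : Cmod (circ_int (fun w => g w * (w * / (w - z)))%C r) <= (2 * PI - 0) * (M * (/ r) ^ n)).
  { apply cint_le_const; [lra| |].
    - apply (cseg_circ (fun w => g w * (w * / (w - z)))%C); [lra|]. intros w Hw.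
      apply cdif_ccont, cdif_mult; [apply Hg; lra|auto].
    - intros t Ht. specialize (HM t Ht). assert (Hm := Cmod_circ r t ltac:(lra)).
      set (w := circ r t) in *. unfold g.
      replace (f w * (/ w) ^ n * (w * / (w - z)))%C with (f w * (w * / (w - z)) * (/ w) ^ n)%C by ring.
      rewrite Cmod_mult, Cmod_pow, Cmod_inv, Hm by (apply <- Cmod_gt_0; lra).
      apply Rmult_le_compat_r; [|easy]. apply pow_le, Rlt_le, Rinv_0_lt_compat. lra. }
  rewrite HC in HB. unfold g in HB.
  rewrite !Cmod_mult, Cmod_pow, Cmod_inv, Cmod_R, Rabs_pos_eq in HB by (easy || lra).
  assert (HB' : Cmod (f z) * (/ Cmod z) ^ n <= M * (/ r) ^ n).
  { apply Rmult_le_reg_l with (2 * PI); [lra|]. lra. }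
  assert (Hzn : 0 < Cmod z ^ n) by now apply pow_lt.
  unfold Rdiv. rewrite Rpow_mult_distr. rewrite pow_inv in HB'.
  apply (Rmult_le_compat_r (Cmod z ^ n)) in HB'; [|lra].
  rewrite Rmult_assoc, Rinv_l, Rmult_1_r in HB' by lra. lra.
Qed.

(** A second-order Cauchy estimate in which no derivative occurs. Its constant depends on [f] only
    through the bound [M], so it is uniform over a family and can be integrated. *)
Lemma Cauchy_quotient f R0 M h k :
  (forall w, Cmod w < R0 -> cdif f w) -> (forall w, Cmod w < R0 -> Cmod (f w) <= M) ->
  0 < Cmod h < R0 / 4 -> 0 < Cmod k < R0 / 4 ->
  Cmod ((f h - f 0) / h - (f k - f 0) / k) <= 16 * M / R0 ^ 2 * Cmod (h - k).
Proof.
  (* On the circle of radius R0 / 2 every point is at distance at least R0 / 4 from h and from k;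
     the two inverse distances give the factor 16 / R0^2. *)
  intros Hf HM Hh Hk. pose proof PI_RGT_0. set (r := R0 / 2). assert (Hr : 0 < r < R0) by (unfold r; lra).
  assert (Hinv : forall x w, Cmod x < R0 / 4 -> Cmod w = r -> (w - x)%C <> 0 /\ R0 / 4 <= Cmod (w - x)).
  { intros x w Hx Hw. pose proof (Cmod_triangle_rev w x).
    split; [apply <- Cmod_gt_0|]; unfold r in *; lra. }
  assert (Hc : forall x w, Cmod x < R0 / 4 -> Cmod w = r -> ccont (fun w => f w * / (w - x))%C w).
  { intros x w Hx Hw. apply cdif_ccont, cdif_mult; [apply Hf; lra|].
    apply cdif_inv_sub. intros ->. unfold r in *. lra. }
  assert (Hc' : forall x w, Cmod x < R0 / 4 -> Cmod w = r -> ccont (fun w => f w * (w * / (w - x)))%C w).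
  { intros x w Hx Hw. apply cdif_ccont, cdif_mult; [apply Hf; lra|].
    apply cdif_Cauchy_kernel. intros ->. unfold r in *. lra. }
  assert (Hq : forall x, 0 < Cmod x < R0 / 4 ->
    (RtoC (2 * PI) * ((f x - f 0) / x) = circ_int (fun w => f w * / (w - x)) r)%C).
  { intros x Hx. assert (Hx0 : x <> 0) by (apply <- Cmod_gt_0; lra).
    replace (RtoC (2 * PI) * ((f x - f 0) / x))%C
      with (/ x * (RtoC (2 * PI) * f x - RtoC (2 * PI) * f 0))%C by now field.
    assert (H00 : Cmod 0 < R0 / 4) by (rewrite Cmod_0; lra).
    rewrite <- (Cauchy_formula f R0 r x), <- (Cauchy_formula f R0 r 0) by (easy || lra || (rewrite ?Cmod_0; unfold r; lra)).
    unfold circ_int.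
    assert (S1 : cseg (fun w => f (circ r w) * (circ r w * / (circ r w - x)))%C 0 (2 * PI)).
    { apply (cseg_circ (fun w => f w * (w * / (w - x)))%C); [lra|]. intros; apply Hc'; lra. }
    assert (S2 : cseg (fun w => f (circ r w) * (circ r w * / (circ r w - 0)))%C 0 (2 * PI)).
    { apply (cseg_circ (fun w => f w * (w * / (w - 0)))%C); [lra|]. intros; apply Hc'; lra. }
    (* The kernels w / (w - x) and w / w differ by x / (w - x), which cancels the division by x. *)
    rewrite <- cint_minus, <- cint_scal; try easy; try lra.
    - apply cint_ext; [lra|]. intros t _. assert (Hm := Cmod_circ r t ltac:(lra)).
      destruct (Hinv x _ ltac:(lra) Hm). destruct (Hinv 0%C _ H00 Hm). field. repeat split; auto.
      intros E. rewrite E, Cmod_0 in Hm. lra.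
    - now apply cseg_minus. }
  assert (HE : (RtoC (2 * PI) * ((f h - f 0) / h - (f k - f 0) / k) =
     cint (fun t => f (circ r t) * / (circ r t - h) - f (circ r t) * / (circ r t - k)) 0 (2 * PI))%C).
  { replace (RtoC (2 * PI) * ((f h - f 0) / h - (f k - f 0) / k))%C with
     (RtoC (2 * PI) * ((f h - f 0) / h) - RtoC (2 * PI) * ((f k - f 0) / k))%C by ring.
    rewrite !Hq by easy. unfold circ_int. rewrite <- cint_minus; [easy|lra|..].
    - apply (cseg_circ (fun w => f w * / (w - h))%C); [lra|]. intros; apply Hc; lra.
    - apply (cseg_circ (fun w => f w * / (w - k))%C); [lra|]. intros; apply Hc; lra. }
  assert (HB : Cmod (RtoC (2 * PI) * ((f h - f 0) / h - (f k - f 0) / k)) <=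
     (2 * PI - 0) * (16 * M / R0 ^ 2 * Cmod (h - k))).
  { rewrite HE. apply cint_le_const; [lra| |].
    - apply cseg_minus.
      + apply (cseg_circ (fun w => f w * / (w - h))%C); [lra|]. intros; apply Hc; lra.
      + apply (cseg_circ (fun w => f w * / (w - k))%C); [lra|]. intros; apply Hc; lra.
    - intros t _. assert (Hm := Cmod_circ r t ltac:(lra)). set (w := circ r t) in *.
      destruct (Hinv h _ ltac:(lra) Hm) as [N1 L1]. destruct (Hinv k _ ltac:(lra) Hm) as [N2 L2].
      replace (f w * / (w - h) - f w * / (w - k))%C with (f w * (h - k) * (/ (w - h) * / (w - k)))%C
        by (field; auto).
      rewrite !Cmod_mult, !Cmod_inv by easy.
      assert (Hfw : Cmod (f w) <= M) by (apply HM; lra).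
      assert (I1 : / Cmod (w - h) <= 4 / R0).
      { replace (4 / R0) with (/ (R0 / 4)) by (field; lra). apply Rinv_le_contravar; lra. }
      assert (I2 : / Cmod (w - k) <= 4 / R0).
      { replace (4 / R0) with (/ (R0 / 4)) by (field; lra). apply Rinv_le_contravar; lra. }
      replace (16 * M / R0 ^ 2 * Cmod (h - k)) with (M * Cmod (h - k) * (4 / R0 * (4 / R0))) by (field; lra).
      assert (0 < / Cmod (w - h)) by (apply Rinv_0_lt_compat; lra).
      assert (0 < / Cmod (w - k)) by (apply Rinv_0_lt_compat; lra).
      apply Rmult_le_compat.
      + apply Rmult_le_pos; apply Cmod_ge_0.
      + apply Rmult_le_pos; lra.
      + apply Rmult_le_compat_r; [apply Cmod_ge_0|easy].
      + apply Rmult_le_compat; lra. }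
  rewrite Cmod_mult, Cmod_R, Rabs_pos_eq in HB by lra.
  apply Rmult_le_reg_l with (2 * PI); lra.
Qed.

(* The limit is the supremum of [q h - K * Cmod h]. *)
Lemma lip_limit (q : C -> R) K r : 0 < r ->
  (forall h k, 0 < Cmod h < r -> 0 < Cmod k < r -> Rabs (q h - q k) <= K * (Cmod h + Cmod k)) ->
  exists l, forall h, 0 < Cmod h < r -> Rabs (q h - l) <= K * Cmod h.
Proof.
  intros Hr H.
  assert (Hx : 0 < Cmod (RtoC (r / 2)) < r) by (rewrite Cmod_R, Rabs_pos_eq; lra).
  assert (Hle : forall h k, 0 < Cmod h < r -> 0 < Cmod k < r ->
    q h - K * Cmod h <= q k + K * Cmod k).
  { intros h k Hh Hk. specialize (H h k Hh Hk). apply Rabs_le_between in H. lra. }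
  destruct (completeness (fun x => exists h, 0 < Cmod h < r /\ x = q h - K * Cmod h)) as [l [L1 L2]].
  - exists (q (RtoC (r / 2)) + K * Cmod (RtoC (r / 2))). intros x [h [Hh ->]]. now apply Hle.
  - eexists. exists (RtoC (r / 2)). split; [easy|reflexivity].
  - exists l. intros h Hh. apply Rabs_le_between. split.
    + assert (l <= q h + K * Cmod h); [|lra]. apply L2. intros x [k [Hk ->]]. now apply Hle.
    + assert (q h - K * Cmod h <= l); [|lra]. apply L1. now exists h.
Qed.

Lemma cdif_translate f p w : cdif f (p + w)%C -> cdif (fun w => f (p + w)%C) w.
Proof.
  intros H. apply (cdif_comp f (fun w => p + w)%C); [easy|].
  apply cdif_plus; [apply cdif_const|apply cdif_id].
Qed.

(** Integrating [Cauchy_quotient] over the parameter shows that the difference quotients of the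
    integral satisfy a Cauchy condition as h tends to 0. The derivative is their limit, found
    separately for real and imaginary parts. *)
Lemma cdif_param_int (H : C -> C -> C) z0 d M : 0 < d ->
  (forall t w, 0 <= t <= 1 -> Cmod (w - z0) < d -> cdif (H (RtoC t)) w /\ Cmod (H (RtoC t) w) <= M) ->
  (forall w, Cmod (w - z0) < d -> cseg (fun t => H t w) 0 1) ->
  cdif (fun z => cint (fun t => H t z) 0 1) z0.
Proof.
  intros Hd Hdif Hcont. set (F := fun z => cint (fun t => H t z) 0 1).
  set (q := fun h => ((F (z0 + h) - F z0) / h)%C).
  set (K := 16 * M / d ^ 2).
  assert (HM : 0 <= M).
  { destruct (Hdif 0 z0) as [_ Hb]; [lra| |].
    - replace (z0 - z0)%C with (RtoC 0) by ring. now rewrite Cmod_0.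
    - pose proof (Cmod_ge_0 (H (RtoC 0) z0)). lra. }
  assert (HK : 0 <= K) by (apply Rdiv_le_0_compat; [lra|apply pow_lt; lra]).
  assert (Hsub : forall h, Cmod h < d -> Cmod (z0 + h - z0) < d).
  { intros h Hh. now replace (z0 + h - z0)%C with h by ring. }
  assert (Hs0 : cseg (fun t => H t z0) 0 1).
  { apply Hcont. replace (z0 - z0)%C with (RtoC 0) by ring. now rewrite Cmod_0. }
  assert (Hq : forall h k, 0 < Cmod h < d / 4 -> 0 < Cmod k < d / 4 ->
    Cmod (q h - q k) <= K * (Cmod h + Cmod k)).
  { intros h k Hh Hk.
    assert (Hsh : forall x, 0 < Cmod x < d / 4 -> cseg (fun t => H t (z0 + x)%C - H t z0)%C 0 1).
    { intros x Hx. apply (cseg_minus (fun t => H t (z0 + x)%C) (fun t => H t z0)); [|easy].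
      apply Hcont, Hsub. lra. }
    assert (Hqx : forall x, 0 < Cmod x < d / 4 ->
      q x = cint (fun t => / x * (H t (z0 + x)%C - H t z0))%C 0 1).
    { intros x Hx. unfold q, F. rewrite (cint_scal (/ x) (fun t => H t (z0 + x)%C - H t z0)%C) by (auto; lra).
      rewrite (cint_minus (fun t => H t (z0 + x)%C) (fun t => H t z0)); auto; [|lra|].
      - unfold Cdiv. ring.
      - apply Hcont, Hsub. lra. }
    rewrite !Hqx by easy.
    rewrite <- (cint_minus (fun t => / h * (H t (z0 + h)%C - H t z0))%C (fun t => / k * (H t (z0 + k)%C - H t z0))%C);
     [|lra|now apply cseg_scal, Hsh..].
    replace (K * (Cmod h + Cmod k)) with ((1 - 0) * (K * (Cmod h + Cmod k))) by ring.
    apply (cint_le_const (fun t => / h * (H t (z0 + h)%C - H t z0) - / k * (H t (z0 + k)%C - H t z0))%C); [lra| |].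
    - apply (cseg_minus (fun t => / h * (H t (z0 + h)%C - H t z0))%C (fun t => / k * (H t (z0 + k)%C - H t z0))%C);
      now apply cseg_scal, Hsh.
    - intros t Ht.
      pose proof (Cauchy_quotient (fun w => H (RtoC t) (z0 + w)%C) d M h k) as HQ.
      cbv beta in HQ. replace (z0 + 0)%C with z0 in HQ by ring.
      replace (/ h * (H t (z0 + h)%C - H t z0) - / k * (H t (z0 + k)%C - H t z0))%C
        with ((H t (z0 + h)%C - H t z0) / h - (H t (z0 + k)%C - H t z0) / k)%C by (unfold Cdiv; ring).
      eapply Rle_trans; [apply HQ|]; auto.
      + intros w Hw. apply cdif_translate. apply Hdif; auto.
      + intros w Hw. apply Hdif; auto.
      + apply Rmult_le_compat_l; [easy|]. unfold Cminus. rewrite <- (Cmod_opp k). apply Cmod_triangle. }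
  destruct (lip_limit (fun h => Re (q h)) K (d / 4)) as [l1 Hl1]; [lra| |].
  { intros h k Hh Hk. eapply Rle_trans; [|apply (Hq h k Hh Hk)].
    apply (re_le_Cmod (q h - q k)). }
  destruct (lip_limit (fun h => Im (q h)) K (d / 4)) as [l2 Hl2]; [lra| |].
  { intros h k Hh Hk. eapply Rle_trans; [|apply (Hq h k Hh Hk)].
    eapply Rle_trans; [|apply Rmax_Cmod]. apply (Rmax_r (Rabs (fst (q h - q k)%C))). }
  exists (l1, l2). intros e He.
  (* Each of the two components contributes K |h|; the added 1 covers K = 0. *)
  exists (Rmin (d / 4) (e / (2 * K + 1))). split.
  { apply Rmin_glb_lt; [lra|]. apply Rdiv_lt_0_compat; lra. }
  intros w Hw. set (h := (w - z0)%C) in *.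
  destruct (Ceq_dec h 0) as [E|Hh0].
  { assert (w = z0) by now apply Ceq_minus. subst w. rewrite E, Cmod_0.
    replace (F z0 - F z0 - (l1, l2) * 0)%C with (RtoC 0) by ring. rewrite Cmod_0. lra. }
  apply Rmin_Rgt in Hw. assert (Hh : 0 < Cmod h < d / 4).
  { split; [now apply -> Cmod_gt_0|lra]. }
  specialize (Hl1 h Hh). specialize (Hl2 h Hh).
  replace (F w - F z0 - (l1, l2) * h)%C with ((q h - (l1, l2)) * h)%C.
  2: { unfold q. replace (z0 + h)%C with w by (unfold h; ring). now field. }
  rewrite Cmod_mult. apply Rmult_le_compat_r; [apply Cmod_ge_0|].
  replace (q h - (l1, l2))%C with (RtoC (Re (q h) - l1) + Ci * RtoC (Im (q h) - l2))%C.
  2: { unfold Re, Im. apply injective_projections; simpl; ring. }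
  eapply Rle_trans; [apply Cmod_pt_le|].
  assert (Hle : Cmod h < e / (2 * K + 1)) by lra. apply Rlt_div_r in Hle; [|lra].
  lra.
Qed.

(** A uniform width for an open set around the compact segment [0, z], together with a uniform bound
    for [f] on the tube. *)
Lemma segment_tube V f z : Copen V -> (forall w, V w -> cdif f w) ->
  (forall t, 0 <= t <= 1 -> V (RtoC t * z)%C) ->
  exists d M, 0 < d /\ forall t w, 0 <= t <= 1 -> Cmod (w - RtoC t * z) < d -> V w /\ Cmod (f w) <= M.
Proof.
  intros HV Hf Hz.
  destruct (interval_uniform (fun d t => 0 < d -> forall w, Cmod (w - RtoC t * z) < d ->
     V w /\ Cmod (f w) <= / d) 0 1) as [d [Hd H]].
  - intros d d' t Hdd H Hd' w Hw. destruct (H ltac:(lra) w ltac:(lra)) as [H1 H2].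
    split; [easy|]. eapply Rle_trans; [apply H2|]. apply Rinv_le_contravar; lra.
  - intros t Ht. destruct (HV _ (Hz t Ht)) as [r [Hr H1]].
    destruct (cdif_ccont _ _ (Hf _ (Hz t Ht)) 1 Rlt_0_1) as [del [Hdel H2]].
    set (m := Rmin r del). assert (Hm : 0 < m) by now apply Rmin_glb_lt.
    set (p := (RtoC t * z)%C) in *. pose proof (Cmod_ge_0 z). pose proof (Cmod_ge_0 (f p)).
    (* A point within d of s z, with |s - t| < d, lies within d (1 + |z|) <= m / 2 of t z. The
       second entry makes [/ d] exceed the local bound |f(p)| + 1. *)
    exists (Rmin (m / (2 * (1 + Cmod z))) (/ (Cmod (f p) + 1))). split.
    { apply Rmin_glb_lt; [apply Rdiv_lt_0_compat; lra|apply Rinv_0_lt_compat; lra]. }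
    intros s Hs Hst Hpos w Hw. set (d := Rmin (m / (2 * (1 + Cmod z))) (/ (Cmod (f p) + 1))) in *.
    assert (Hd1 : d <= m / (2 * (1 + Cmod z))) by apply Rmin_l.
    assert (Hd2 : d <= / (Cmod (f p) + 1)) by apply Rmin_r.
    assert (Hwp : Cmod (w - p) < m).
    { unfold p. replace (w - t * z)%C with ((w - s * z) + (s - t) * z)%C by ring.
      eapply Rle_lt_trans; [apply Cmod_triangle|]. rewrite Cmod_mult, Cmod_RtoC_minus.
      apply Rle_div_r in Hd1; [|lra].
      assert (Rabs (s - t) * Cmod z <= d * Cmod z) by (apply Rmult_le_compat_r; lra). nra. }
    pose proof (Rmin_l r del). pose proof (Rmin_r r del). fold m in H3, H4.
    split; [apply H1; lra|]. specialize (H2 w ltac:(lra)).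
    pose proof (Cmod_triangle_rev (f w) (f p)).
    apply Rle_trans with (Cmod (f p) + 1); [lra|].
    apply Rle_trans with (/ / (Cmod (f p) + 1)); [rewrite Rinv_inv; lra|]. now apply Rinv_le_contravar.
  - exists d, (/ d). split; [easy|]. intros t w Ht Hw. exact (H t Ht Hd w Hw).
Qed.

(** Discs of one common radius d march along the segment. The centre of each new disc lies inside a
    disc where [f] already vanishes, and [vanishing_disc] spreads the zeros to the whole new
    disc. *)
Theorem segment_identity V (f : C -> C) z rho : Copen V -> (forall w, V w -> cdif f w) ->
  (forall t, 0 <= t <= 1 -> V (RtoC t * z)%C) -> 0 < rho -> (forall w, Cmod w < rho -> f w = 0) ->
  f z = 0.
Proof.
  intros HV Hf Hz Hrho H0.
  destruct (segment_tube V f z HV Hf Hz) as [d [M [Hd HT]]].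
  assert (Hext : forall t r, 0 <= t <= 1 -> 0 < r ->
     (forall w, Cmod (w - RtoC t * z) < r -> f w = 0) ->
     (forall w, Cmod (w - RtoC t * z) < d -> f w = 0)).
  { intros t r Ht Hr Hv w Hw.
    assert (E := vanishing_disc (fun v => f (RtoC t * z + v)%C) d r (w - RtoC t * z) Hr Hw).
    cbv beta in E. replace (RtoC t * z + (w - RtoC t * z))%C with w in E by ring. apply E.
    - intros v Hv'. apply cdif_translate, Hf. apply (HT t); [easy|].
      now replace (RtoC t * z + v - RtoC t * z)%C with v by ring.
    - intros v Hv'. apply Hv. now replace (RtoC t * z + v - RtoC t * z)%C with v by ring. }
  (* A step eta in the parameter moves the centre by eta |z| < d. *)
  set (eta := d / (2 * (1 + Cmod z))). pose proof (Cmod_ge_0 z).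
  assert (Heta : 0 < eta) by (apply Rdiv_lt_0_compat; lra).
  assert (Hez : eta * Cmod z < d).
  { assert (eta * (2 * (1 + Cmod z)) = d) by (unfold eta; field; lra). nra. }
  assert (Hstep : forall n t, 0 <= t <= 1 -> t <= INR n * eta ->
     forall w, Cmod (w - RtoC t * z) < d -> f w = 0).
  { induction n as [|n IH]; intros t Ht Htn.
    - simpl in Htn. apply (Hext t rho); auto. intros w Hw. apply H0.
      replace (w - t * z)%C with w in Hw; [easy|]. replace t with 0 by lra. ring.
    - rewrite S_INR in Htn. set (s := Rmax 0 (t - eta)).
      assert (Hs1 : 0 <= s) by apply Rmax_l. assert (Hs2 : t - eta <= s) by apply Rmax_r.
      assert (Hs3 : s <= t) by (apply Rmax_lub; lra).
      assert (Hs4 : s <= INR n * eta).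
      { apply Rmax_lub; [|lra]. apply Rmult_le_pos; [apply pos_INR|lra]. }
      assert (Hts : Cmod (RtoC t * z - RtoC s * z) < d).
      { replace (t * z - s * z)%C with ((t - s) * z)%C by ring.
        rewrite Cmod_mult, Cmod_RtoC_minus, Rabs_pos_eq by lra.
        eapply Rle_lt_trans; [|apply Hez]. apply Rmult_le_compat_r; lra. }
      apply (Hext t (d - Cmod (RtoC t * z - RtoC s * z))); auto; [lra|].
      intros w Hw. apply (IH s); [lra|easy|].
      replace (w - s * z)%C with ((w - t * z) + (t * z - s * z))%C by ring.
      eapply Rle_lt_trans; [apply Cmod_triangle|]. lra. }
  (* One step more than the integer part of 1 / eta reaches t = 1. *)
  destruct (nfloor_ex (/ eta)) as [n Hn]; [now apply Rlt_le, Rinv_0_lt_compat|].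
  apply (Hstep (S n) 1); [lra| |].
  - rewrite S_INR. apply Rmult_le_reg_r with (/ eta); [now apply Rinv_0_lt_compat|].
    rewrite Rmult_assoc, Rinv_r by lra. lra.
  - replace (z - 1 * z)%C with (RtoC 0) by ring. now rewrite Cmod_0.
Qed.

(** * Power series and the convolution *)

Definition csum (u : nat -> C) (n : nat) : C := sum_n (G := C_AbelianMonoid) u n.
Notation cpseries := (is_pseries (K := C_AbsRing) (V := C_NormedModule)).

Lemma csum_S (u : nat -> C) n : csum u (S n) = (csum u n + u (S n))%C.
Proof. apply (sum_Sn (G := C_AbelianMonoid)). Qed.

Lemma csum_0 (u : nat -> C) : csum u 0 = u O.
Proof. apply (sum_O (G := C_AbelianMonoid)). Qed.

Lemma csum_ext (u v : nat -> C) n : (forall k, (k <= n)%nat -> u k = v k) -> csum u n = csum v n.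
Proof. apply (sum_n_ext_loc (G := C_AbelianMonoid)). Qed.

Lemma csum_scal c (u : nat -> C) n : csum (fun k => c * u k)%C n = (c * csum u n)%C.
Proof. apply (sum_n_mult_l (K := C_Ring)). Qed.

Lemma csum_plus (u v : nat -> C) n : csum (fun k => u k + v k)%C n = (csum u n + csum v n)%C.
Proof. apply (sum_n_plus (G := C_AbelianMonoid)). Qed.

Lemma csum_shift (u : nat -> C) n : csum u (S n) = (u O + csum (fun k => u (S k)) n)%C.
Proof.
  induction n as [|n IH].
  - now rewrite csum_S, !csum_0.
  - rewrite csum_S, IH, csum_S. ring.
Qed.

(** The balls of [C_NormedModule] are squares; replacing them by discs costs a factor sqrt 2,
    absorbed by taking e / 2. *)
Lemma cpseries_iff (al : nat -> C) z l : cpseries al z l <->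
  (forall e, 0 < e -> exists N, forall n, (N <= n)%nat -> Cmod (csum (fun k => al k * z ^ k)%C n - l) < e).
Proof.
  assert (E : forall n, csum (fun k => al k * z ^ k)%C n =
     sum_n (G := C_NormedModule) (fun k => scal (K := C_AbsRing) (V := C_NormedModule) (pow_n (K := C_AbsRing) z k) (al k)) n).
  { intros n. apply csum_ext. intros k _. apply Cmult_comm. }
  unfold is_pseries, is_series. split.
  - intros H e He. assert (He2 : 0 < e / 2) by lra.
    destruct (proj1 (filterlim_locally _ _) H (mkposreal _ He2)) as [N HN].
    exists N. intros n Hn. specialize (HN n Hn). rewrite E.
    eapply Rlt_le_trans; [apply (C_NormedModule_mixin_compat2 _ _ (mkposreal _ He2) HN)|].
    simpl. assert (sqrt 2 <= 2); [|nra].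
    rewrite <- (sqrt_pow2 2) at 2 by lra. apply sqrt_le_1_alt. lra.
  - intros H. apply (proj2 (filterlim_locally _ _)). intros e.
    destruct (H e (cond_pos e)) as [N HN]. exists N. intros n Hn.
    apply C_NormedModule_mixin_compat1. rewrite <- E. now apply HN.
Qed.

Lemma cpseries_unique al z l m : cpseries al z l -> cpseries al z m -> l = m.
Proof.
  rewrite !cpseries_iff. intros Hl Hm. apply Ceq_minus, Cmod_eq_0, Rle_antisym; [|apply Cmod_ge_0].
  apply le_epsilon. intros e He. rewrite Rplus_0_l.
  destruct (Hl (e / 2)) as [N1 H1]; [lra|]. destruct (Hm (e / 2)) as [N2 H2]; [lra|].
  specialize (H1 (N1 + N2)%nat ltac:(lia)). specialize (H2 (N1 + N2)%nat ltac:(lia)).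
  set (s := csum _ _) in *. replace (l - m)%C with (- (s - l) + (s - m))%C by ring.
  eapply Rle_trans; [apply Cmod_triangle|]. rewrite Cmod_opp. lra.
Qed.

Lemma eventually_bounded (u : nat -> R) B N : (forall n, (N <= n)%nat -> u n <= B) ->
  exists A, 0 <= A /\ forall n, u n <= A.
Proof.
  revert B. induction N as [|N IH]; intros B H.
  - exists (Rmax 0 B). split; [apply Rmax_l|]. intros n.
    eapply Rle_trans; [apply H; lia|apply Rmax_r].
  - apply (IH (Rmax B (u N))). intros n Hn.
    destruct (Nat.eq_dec n N) as [->|Hne]; [apply Rmax_r|].
    eapply Rle_trans; [apply H; lia|apply Rmax_l].
Qed.

Lemma cpseries_coef_bound al (z l : C) : cpseries al z l ->
  exists A, 0 <= A /\ forall k, Cmod (al k * z ^ k)%C <= A.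
Proof.
  rewrite cpseries_iff. intros H. destruct (H 1 Rlt_0_1) as [N HN].
  apply (eventually_bounded (fun k => Cmod (al k * z ^ k)%C) 2 (S N)). intros [|n] Hn; [lia|].
  pose proof (HN n ltac:(lia)) as H1. pose proof (HN (S n) ltac:(lia)) as H2.
  rewrite csum_S in H2. set (s := csum _ _) in *. set (x := (al (S n) * z ^ S n)%C) in *.
  replace x with ((s + x - l) + - (s - l))%C by ring.
  eapply Rle_trans; [apply Cmod_triangle|]. rewrite Cmod_opp. lra.
Qed.

Lemma geom_tail (u : nat -> C) A n j : (forall k, Cmod (u k) <= A * (1 / 4) ^ k) ->
  Cmod (csum u (n + j) - csum u n) <= A * (1 / 4) ^ n * (1 - (1 / 4) ^ j).
Proof.
  intros H. assert (HA : 0 <= A).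
  { specialize (H O). pose proof (Cmod_ge_0 (u O)). simpl in H. lra. }
  induction j as [|j IH].
  - rewrite Nat.add_0_r. replace (_ - _)%C with (RtoC 0) by ring. rewrite Cmod_0. simpl. lra.
  - rewrite Nat.add_succ_r, csum_S.
    replace (csum u (n + j) + u (S (n + j)) - csum u n)%C
      with ((csum u (n + j) - csum u n) + u (S (n + j)))%C by ring.
    eapply Rle_trans; [apply Cmod_triangle|]. specialize (H (S (n + j))).
    simpl in *. rewrite pow_add in H.
    assert (0 <= A * ((1 / 4) ^ n * (1 / 4) ^ j)).
    { apply Rmult_le_pos; [easy|]. apply Rmult_le_pos; apply pow_le; lra. }
    nra.
Qed.

Lemma cpseries_tail al z l A n : cpseries al z l -> (forall k, Cmod (al k * z ^ k)%C <= A * (1 / 4) ^ k) ->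
  Cmod (l - csum (fun k => al k * z ^ k)%C n) <= A * (1 / 4) ^ n.
Proof.
  intros Hl H. rewrite cpseries_iff in Hl.
  assert (HA : 0 <= A).
  { specialize (H O). pose proof (Cmod_ge_0 (al O * z ^ 0)%C). simpl in *. lra. }
  apply le_epsilon. intros e He. destruct (Hl e He) as [N HN].
  specialize (HN (n + N)%nat ltac:(lia)). pose proof (geom_tail _ A n N H) as HT.
  set (s := csum _ n) in *. set (t := csum _ (n + N)) in *.
  replace (l - s)%C with ((t - s) + - (t - l))%C by ring.
  eapply Rle_trans; [apply Cmod_triangle|]. rewrite Cmod_opp.
  assert (0 <= A * (1 / 4) ^ n) by (apply Rmult_le_pos; [easy|apply pow_le; lra]).
  assert (0 <= (1 / 4) ^ N) by (apply pow_le; lra). nra.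
Qed.

(** The triangle i + j <= n is summed by diagonals on the left and by rows on the right. *)
Lemma csum_triangle (x y : nat -> C) n :
  csum (fun k => csum (fun i => x i * y (k - i)%nat)%C k) n = csum (fun i => x i * csum y (n - i))%C n.
Proof.
  induction n as [|n IH].
  - now rewrite !csum_0.
  - rewrite csum_S, IH, !(csum_S _ n), Nat.sub_diag, csum_0.
    rewrite (csum_ext (fun i => x i * csum y (S n - i))%C
       (fun i => x i * csum y (n - i) + x i * y (S n - i)%nat)%C).
    + rewrite csum_plus. ring.
    + intros k Hk. rewrite Nat.sub_succ_l, csum_S by easy. ring.
Qed.

Lemma csum_le (u : nat -> C) B n : (forall k, (k <= n)%nat -> Cmod (u k) <= B) ->
  Cmod (csum u n) <= (INR n + 1) * B.
Proof.
  induction n as [|n IH]; intros H.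
  - rewrite csum_0. simpl. specialize (H O (Nat.le_refl _)). lra.
  - rewrite csum_S, S_INR. eapply Rle_trans; [apply Cmod_triangle|].
    specialize (IH (fun k Hk => H k ltac:(lia))). specialize (H (S n) (Nat.le_refl _)). lra.
Qed.

(** The linear factor counts the terms of the Cauchy product error; it is absorbed by weakening the
    ratio from 1/4 to 1/2. *)
Lemma quarter_poly n : (INR n + 3) * (1 / 4) ^ n <= 3 * (1 / 2) ^ n.
Proof.
  replace ((1 / 4) ^ n) with ((1 / 2) ^ n * (1 / 2) ^ n) by (rewrite <- Rpow_mult_distr; f_equal; lra).
  assert (H : (INR n + 3) * (1 / 2) ^ n <= 3).
  { induction n as [|n IH]; [simpl; lra|]. rewrite S_INR. simpl.
    pose proof (pos_INR n). assert (0 < (1 / 2) ^ n) by (apply pow_lt; lra). nra. }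
  assert (0 <= (1 / 2) ^ n) by (apply pow_le; lra). nra.
Qed.

(** An explicit error, depending on the series only through [A] and [B], so that it holds uniformly
    along the segment of integration. *)
Lemma Cauchy_product_error al be z w l m A B n : cpseries al z l -> cpseries be w m ->
  (forall k, Cmod (al k * z ^ k)%C <= A * (1 / 4) ^ k) ->
  (forall k, Cmod (be k * w ^ k)%C <= B * (1 / 4) ^ k) ->
  Cmod (l * m - csum (fun k => csum (fun i => (al i * z ^ i) * (be (k - i)%nat * w ^ (k - i)))%C k) n)
    <= 3 * A * B * (1 / 2) ^ n.
Proof.
  intros Hl Hm Ha Hb.
  assert (HA : 0 <= A).
  { specialize (Ha O). pose proof (Cmod_ge_0 (al O * z ^ 0)%C). simpl in *. lra. }
  assert (HB : 0 <= B).
  { specialize (Hb O). pose proof (Cmod_ge_0 (be O * w ^ 0)%C). simpl in *. lra. }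
  set (x := fun i => (al i * z ^ i)%C) in *. set (y := fun i => (be i * w ^ i)%C) in *.
  rewrite (csum_triangle x y).
  assert (Hm2 : Cmod m <= 2 * B).
  { pose proof (cpseries_tail be w m B 0 Hm Hb) as H. fold y in H. rewrite csum_0 in H.
    pose proof (Cmod_triangle_rev m (y O)). specialize (Hb O). fold (y O) in Hb. simpl in *. lra. }
  (* The tail of the first series times m, plus each early term times a tail of the second. With |m|
     <= 2 B these give the weights 2 and n + 1, hence n + 3. *)
  replace (l * m - csum (fun i => x i * csum y (n - i)) n)%C
    with ((l - csum x n) * m + csum (fun i => x i * (m - csum y (n - i))) n)%C.
  2: { replace (csum (fun i => x i * (m - csum y (n - i))) n)%C with
         (m * csum x n - csum (fun i => x i * csum y (n - i)) n)%C; [ring|].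
       rewrite <- csum_scal.
       replace (- csum (fun i => x i * csum y (n - i)) n)%C with (csum (fun i => (- (1)) * (x i * csum y (n - i))) n)%C
         by (rewrite csum_scal; ring).
       unfold Cminus.
       replace (- csum (fun i => x i * csum y (n - i)) n)%C with (csum (fun i => (- (1)) * (x i * csum y (n - i))) n)%C
         by (rewrite csum_scal; ring).
       rewrite <- csum_plus. apply csum_ext. intros k _. ring. }
  eapply Rle_trans; [apply Cmod_triangle|]. rewrite Cmod_mult.
  assert (H1 : Cmod (l - csum x n) * Cmod m <= A * (1 / 4) ^ n * (2 * B)).
  { apply Rmult_le_compat; try apply Cmod_ge_0; [|easy]. now apply cpseries_tail. }
  assert (H2 : Cmod (csum (fun i => x i * (m - csum y (n - i))) n)%C <= (INR n + 1) * (A * B * (1 / 4) ^ n)).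
  { apply csum_le. intros k Hk. rewrite Cmod_mult.
    replace (A * B * (1 / 4) ^ n) with (A * (1 / 4) ^ k * (B * (1 / 4) ^ (n - k))).
    - apply Rmult_le_compat; try apply Cmod_ge_0; [apply Ha|]. now apply cpseries_tail.
    - replace ((1 / 4) ^ n) with ((1 / 4) ^ k * (1 / 4) ^ (n - k)); [ring|].
      rewrite <- pow_add. f_equal. lia. }
  pose proof (quarter_poly n). assert (0 <= A * B) by now apply Rmult_le_pos. nra.
Qed.

(** * The beta integral *)

Lemma cder_pow_S n z : cder (fun w => w ^ S n)%C z (RtoC (INR (S n)) * z ^ n)%C.
Proof.
  induction n as [|n IH].
  - apply (cder_eq _ _ (1 * 1 + z * 0)%C).
    + apply (cder_mult (fun w => w) (fun _ => RtoC 1)); [apply cder_id|apply cder_const].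
    + simpl. ring.
  - apply (cder_eq _ _ (1 * z ^ S n + z * (RtoC (INR (S n)) * z ^ n))%C).
    + apply (cder_mult (fun w => w) (fun w => w ^ S n)%C); [apply cder_id|easy].
    + rewrite (S_INR (S n)), RtoC_plus. simpl Cpow. ring.
Qed.

Lemma ccont_pow f n z : ccont f z -> ccont (fun w => f w ^ n)%C z.
Proof.
  intros H. induction n as [|n IH]; [exact (ccont_const 1%C z)|].
  now apply (ccont_mult f (fun w => f w ^ n)%C).
Qed.

Lemma beta_cont i j z : ccont (fun t => t ^ i * (1 - t) ^ j)%C z.
Proof.
  apply ccont_mult; apply ccont_pow; [apply ccont_id|].
  apply ccont_minus; [apply ccont_const|apply ccont_id].
Qed.

(** Induction on j: t^(i+1) (1 - t)^(j+1) vanishes at 0 and 1, so its derivative integrates to 0,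
    which trades one power of 1 - t for one of t. *)
Lemma beta_integral i j : cint (fun t => t ^ i * (1 - t) ^ j)%C 0 1 =
  RtoC (INR (fact i) * INR (fact j) / INR (fact (i + j + 1))).
Proof.
  revert i. induction j as [|j IH]; intros i.
  - assert (Hi : RtoC (INR (S i)) <> RtoC 0) by (intros E; apply RtoC_inj in E; revert E; now apply not_0_INR).
    rewrite (cint_FTC (fun w => / RtoC (INR (S i)) * w ^ S i)%C); [|lra| |].
    + rewrite Nat.add_0_r, Nat.add_1_r. change (fact (S i)) with (S i * fact i)%nat. rewrite mult_INR.
      replace (INR (fact i) * INR (fact 0) / (INR (S i) * INR (fact i))) with (/ INR (S i)).
      2: { simpl (fact 0). simpl (INR 1). field. split; [apply INR_fact_neq_0|now apply not_0_INR]. }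
      rewrite RtoC_inv by now apply not_0_INR. rewrite !Cpow_S, Cpow_1_l. ring.
    + intros t _.
      apply (cder_eq _ _ (0 * RtoC t ^ S i + / RtoC (INR (S i)) * (RtoC (INR (S i)) * RtoC t ^ i))%C).
      * apply (cder_mult (fun _ => / RtoC (INR (S i)))%C (fun w => w ^ S i)%C); [apply cder_const|apply cder_pow_S].
      * simpl ((1 - t) ^ 0)%C. now field.
    + intros t _. apply beta_cont.
  - assert (HS : forall k z, cseg (fun t => k * (t ^ z * (1 - t) ^ S j))%C 0 1).
    { intros k z. apply (cseg_scal k (fun t => t ^ z * (1 - t) ^ S j)%C). intros t _. apply beta_cont. }
    assert (H : cint (fun t => RtoC (INR (S i)) * (t ^ i * (1 - t) ^ S j) -
        RtoC (INR (S j)) * (t ^ S i * (1 - t) ^ j))%C 0 1 = 0).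
    { rewrite (cint_FTC (fun t => t ^ S i * (1 - t) ^ S j)%C); [|lra| |].
      - rewrite !Cpow_S. ring.
      - intros t _.
        apply (cder_eq _ _ (RtoC (INR (S i)) * RtoC t ^ i * (1 - RtoC t) ^ S j +
           RtoC t ^ S i * ((0 - 1) * (RtoC (INR (S j)) * (1 - RtoC t) ^ j)))%C); [|ring].
        apply (cder_mult (fun t => t ^ S i)%C (fun t => (1 - t) ^ S j)%C); [apply cder_pow_S|].
        apply (cder_comp (fun t => t ^ S j)%C (fun t => 1 - t)%C); [apply cder_pow_S|].
        apply cder_minus; [apply cder_const|apply cder_id].
      - intros t _. apply ccont_minus; (apply ccont_mult; [apply ccont_const|apply beta_cont]). }
    rewrite (cint_minus (fun t => RtoC (INR (S i)) * (t ^ i * (1 - t) ^ S j))%C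
        (fun t => RtoC (INR (S j)) * (t ^ S i * (1 - t) ^ j))%C) in H;
      [|lra|intros t _; apply ccont_mult; [apply ccont_const|apply beta_cont]..].
    rewrite (cint_scal (RtoC (INR (S i))) (fun t => t ^ i * (1 - t) ^ S j)%C) in H; [|lra|intros t _; apply beta_cont].
    rewrite (cint_scal (RtoC (INR (S j))) (fun t => t ^ S i * (1 - t) ^ j)%C) in H; [|lra|intros t _; apply beta_cont].
    rewrite IH in H. apply (proj2 (Ceq_minus _ _)) in H.
    assert (Hi0 : INR (S i) <> 0) by now apply not_0_INR.
    assert (Hi : RtoC (INR (S i)) <> RtoC 0) by (intros E; now apply RtoC_inj in E).
    replace (cint (fun t => t ^ i * (1 - t) ^ S j)%C 0 1) with
      (/ RtoC (INR (S i)) * (RtoC (INR (S i)) * cint (fun t => t ^ i * (1 - t) ^ S j)%C 0 1))%C by now field.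
    rewrite H, <- RtoC_inv, <- !RtoC_mult by easy. f_equal.
    replace (S i + j + 1)%nat with (i + S j + 1)%nat by lia.
    change (fact (S i)) with (S i * fact i)%nat. change (fact (S j)) with (S j * fact j)%nat.
    rewrite !mult_INR. field. split; [apply INR_fact_neq_0|easy].
Qed.

Lemma cint_csum (F : nat -> C -> C) a b n : a <= b -> (forall k, cseg (F k) a b) ->
  cint (fun t => csum (fun k => F k t) n) a b = csum (fun k => cint (F k) a b) n /\
  cseg (fun t => csum (fun k => F k t) n) a b.
Proof.
  intros Hab HF. induction n as [|n [IH1 IH2]].
  - replace (fun t => csum (fun k => F k t) 0) with (F O).
    + now rewrite csum_0.
    + apply functional_extensionality. intros t. now rewrite csum_0.
  - replace (fun t => csum (fun k => F k t) (S n)) with (fun t => csum (fun k => F k t) n + F (S n) t)%C.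
    + rewrite csum_S, <- IH1. split; [now apply cint_plus|now apply cseg_plus].
    + apply functional_extensionality. intros t. now rewrite csum_S.
Qed.

(** The substitution w = t z moves z from the path into the integrand, so the integral becomes one
    over the fixed interval [0, 1] with z as a parameter. *)
Definition conv (f1 f2 : C -> C) (z : C) : C :=
  (z * cint (fun t => f1 (t * z) * f2 ((1 - t) * z)) 0 1)%C.

Lemma cseg_conv f1 f2 z :
  (forall t, 0 <= t <= 1 -> ccont f1 (RtoC t * z)%C) -> (forall t, 0 <= t <= 1 -> ccont f2 (RtoC t * z)%C) ->
  cseg (fun t => f1 (t * z) * f2 ((1 - t) * z))%C 0 1.
Proof.
  intros H1 H2 t Ht. apply ccont_mult.
  - apply (ccont_comp f1 (fun t => t * z)%C); [|now apply H1].
    apply ccont_mult; [apply ccont_id|apply ccont_const].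
  - apply (ccont_comp f2 (fun t => (1 - t) * z)%C).
    + apply ccont_mult; [apply ccont_minus; [apply ccont_const|apply ccont_id]|apply ccont_const].
    + rewrite <- RtoC_minus. apply H2. lra.
Qed.

Lemma conv_cdif V f1 f2 z : Copen V -> (forall w, V w -> cdif f1 w) -> (forall w, V w -> cdif f2 w) ->
  (forall t, 0 <= t <= 1 -> V (RtoC t * z)%C) -> cdif (conv f1 f2) z.
Proof.
  intros HV H1 H2 Hz. apply cdif_mult; [apply cdif_id|].
  destruct (segment_tube V f1 z HV H1 Hz) as [d1 [M1 [Hd1 T1]]].
  destruct (segment_tube V f2 z HV H2 Hz) as [d2 [M2 [Hd2 T2]]].
  assert (Hsub : forall t w, 0 <= t <= 1 -> Cmod (w - z) < Rmin d1 d2 ->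
    Cmod (RtoC t * w - RtoC t * z) < Rmin d1 d2).
  { intros t w Ht Hw. replace (t * w - t * z)%C with (RtoC t * (w - z))%C by ring.
    rewrite Cmod_mult, Cmod_R, Rabs_pos_eq by lra. pose proof (Cmod_ge_0 (w - z)). nra. }
  assert (Hl : forall x, x < Rmin d1 d2 -> x < d1) by (intros x Hx; eapply Rlt_le_trans; [apply Hx|apply Rmin_l]).
  assert (Hr : forall x, x < Rmin d1 d2 -> x < d2) by (intros x Hx; eapply Rlt_le_trans; [apply Hx|apply Rmin_r]).
  apply (cdif_param_int (fun t z => f1 (t * z) * f2 ((1 - t) * z))%C z (Rmin d1 d2) (M1 * M2)).
  - now apply Rmin_glb_lt.
  - intros t w Ht Hw. rewrite <- RtoC_minus.
    assert (Ht' : 0 <= 1 - t <= 1) by lra.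
    destruct (T1 t _ Ht (Hl _ (Hsub t w Ht Hw))) as [A1 B1].
    destruct (T2 (1 - t) _ Ht' (Hr _ (Hsub _ w Ht' Hw))) as [A2 B2].
    split.
    + apply cdif_mult.
      * apply (cdif_comp f1 (fun z => t * z)%C); [now apply H1|]. apply cdif_mult; [apply cdif_const|apply cdif_id].
      * apply (cdif_comp f2 (fun z => RtoC (1 - t) * z)%C); [now apply H2|]. apply cdif_mult; [apply cdif_const|apply cdif_id].
    + rewrite Cmod_mult. apply Rmult_le_compat; try apply Cmod_ge_0; easy.
  - intros w Hw. apply cseg_conv; intros t Ht; apply cdif_ccont.
    + apply H1. apply (T1 t _ Ht). auto.
    + apply H2. apply (T2 t _ Ht). auto.
Qed.

(** The Cauchy product is integrated term by term, each monomial in t by [beta_integral]. The factor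
    z in front of the integral shifts the degrees by one, whence the zero constant coefficient. *)
Lemma conv_series al be f1 f2 r : 0 < r ->
  (forall w, Cmod w < r -> cdif f1 w) -> (forall w, Cmod w < r -> cdif f2 w) ->
  (forall w, Cmod w < r -> cpseries al w (f1 w)) -> (forall w, Cmod w < r -> cpseries be w (f2 w)) ->
  forall z, Cmod z < r / 8 ->
  cpseries (fun m => match m with O => RtoC 0 | S k =>
    (/ RtoC (INR (fact (S k))) * csum (fun i => (RtoC (INR (fact i)) * al i) * (RtoC (INR (fact (k - i))) * be (k - i)%nat)) k)%C end)
    z (conv f1 f2 z).
Proof.
  intros Hr D1 D2 S1 S2 z Hz. pose proof (Cmod_ge_0 z).
  set (p := RtoC (r / 2)). assert (Hp : Cmod p = r / 2) by (unfold p; rewrite Cmod_R; apply Rabs_pos_eq; lra).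
  destruct (cpseries_coef_bound al p _ (S1 p ltac:(lra))) as [A [HA HAk]].
  destruct (cpseries_coef_bound be p _ (S2 p ltac:(lra))) as [B [HB HBk]].
  (* The terms are bounded at the point r / 2, and r / 8 is a quarter of it: this is the origin of
     the ratio 1/4. *)
  assert (Hgeo : forall c E w k, 0 <= E -> Cmod (c * p ^ k)%C <= E -> Cmod w <= r / 8 ->
     Cmod (c * w ^ k)%C <= E * (1 / 4) ^ k).
  { intros c E w k HE Hc Hw. rewrite !Cmod_mult, !Cmod_pow, Hp in *.
    apply Rle_trans with (Cmod c * (r / 8) ^ k).
    - apply Rmult_le_compat_l; [apply Cmod_ge_0|]. apply pow_incr. split; [apply Cmod_ge_0|easy].
    - replace (r / 8) with (r / 2 * (1 / 4)) by lra. rewrite Rpow_mult_distr, <- Rmult_assoc.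
      apply Rmult_le_compat_r; [apply pow_le; lra|easy]. }
  assert (Hseg : forall t, 0 <= t <= 1 -> Cmod (RtoC t * z) <= r / 8).
  { intros t Ht. rewrite Cmod_mult, Cmod_R, Rabs_pos_eq by lra. nra. }
  assert (HD : forall t, 0 <= t <= 1 -> Cmod (RtoC t * z) < r) by (intros t Ht; specialize (Hseg t Ht); lra).
  set (T := fun n t => csum (fun k => csum (fun i =>
     (al i * (t * z) ^ i) * (be (k - i)%nat * ((1 - t) * z) ^ (k - i)))%C k) n).
  set (c := fun k i => (al i * be (k - i)%nat * z ^ k)%C).
  set (TF := fun k t => csum (fun i => c k i * (t ^ i * (1 - t) ^ (k - i)))%C k).
  (* Pulling z^k out of the k-th diagonal leaves beta integrands in t. *)
  assert (ET : forall n t, T n t = csum (fun k => TF k t) n).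
  { intros n t. apply csum_ext. intros k _. apply csum_ext. intros i Hi. unfold c.
    rewrite !Cpow_mult_l. replace (z ^ k)%C with (z ^ i * z ^ (k - i))%C; [ring|].
    rewrite <- Cpow_add_r. f_equal. lia. }
  assert (HTF : forall k, cint (TF k) 0 1 = csum (fun i => c k i * RtoC (INR (fact i) * INR (fact (k - i)) / INR (fact (S k))))%C k
     /\ cseg (TF k) 0 1).
  { intros k. destruct (cint_csum (fun i t => c k i * (t ^ i * (1 - t) ^ (k - i)))%C 0 1 k) as [E1 E2]; [lra| |].
    - intros i. apply (cseg_scal (c k i) (fun t => t ^ i * (1 - t) ^ (k - i))%C). intros t _. apply beta_cont.
    - split; [|exact E2]. unfold TF. rewrite E1. apply csum_ext. intros i Hi.
      rewrite (cint_scal (c k i) (fun t => t ^ i * (1 - t) ^ (k - i))%C), beta_integral; [|lra|intros t _; apply beta_cont].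
      do 6 f_equal. lia. }
  assert (HI : forall n, Cmod (cint (fun t => f1 (t * z) * f2 ((1 - t) * z))%C 0 1 -
      csum (fun k => cint (TF k) 0 1) n) <= 3 * A * B * (1 / 2) ^ n).
  { intros n. destruct (cint_csum TF 0 1 n) as [E1 E2]; [lra|apply HTF|].
    rewrite <- E1.
    assert (SC : cseg (fun t => f1 (t * z) * f2 ((1 - t) * z))%C 0 1).
    { apply cseg_conv; intros t Ht; apply cdif_ccont; [apply D1|apply D2]; auto. }
    rewrite <- (cint_minus (fun t => f1 (t * z) * f2 ((1 - t) * z))%C (fun t => csum (fun k => TF k t) n)); auto; [|lra].
    replace (3 * A * B * (1 / 2) ^ n) with ((1 - 0) * (3 * A * B * (1 / 2) ^ n)) by ring.
    apply cint_le_const; [lra|now apply cseg_minus|].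
    intros t Ht. rewrite <- ET. assert (Ht' : 0 <= 1 - t <= 1) by lra.
    apply Cauchy_product_error.
    - apply S1. auto.
    - rewrite <- RtoC_minus. apply S2. auto.
    - intros k. apply Hgeo; auto.
    - intros k. rewrite <- RtoC_minus. apply Hgeo; auto. }
  rewrite cpseries_iff. intros e He.
  set (Q := 3 * A * B * r + 1). assert (HQ : 0 < Q).
  { unfold Q. assert (0 <= 3 * A * B * r); [|lra]. repeat apply Rmult_le_pos; lra. }
  destruct (half_pow_small Q e) as [N HN]; [lra|easy|].
  exists (S N). intros [|n] Hn; [lia|]. specialize (HN n ltac:(lia)). specialize (HI n).
  rewrite csum_shift. unfold conv.
  replace (csum _ n) with (z * csum (fun k => cint (TF k) 0 1) n)%C.
  2: { rewrite <- csum_scal. apply csum_ext. intros k _. rewrite (proj1 (HTF k)).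
       rewrite <- Cmult_assoc, (Cmult_comm (csum _ k)), Cmult_assoc, <- !csum_scal.
       apply csum_ext. intros i Hi. unfold c. rewrite Cpow_S.
       unfold Rdiv. rewrite !RtoC_mult, RtoC_inv by apply INR_fact_neq_0. ring. }
  set (I := cint _ 0 1) in *. set (s := csum (fun k => cint (TF k) 0 1) n) in *.
  replace (0 * z ^ 0 + z * s - z * I)%C with (- (z * (I - s)))%C by ring.
  rewrite Cmod_opp, Cmod_mult. eapply Rle_lt_trans; [|apply HN].
  apply Rle_trans with (r * (3 * A * B * (1 / 2) ^ n)).
  - apply Rmult_le_compat; try apply Cmod_ge_0; lra.
  - unfold Rdiv at 2. rewrite <- pow_inv. replace (/ 2) with (1 / 2) by lra.
    assert (0 <= (1 / 2) ^ n) by (apply pow_le; lra). unfold Q. nra.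
Qed.

(** * Borel extensions and norms *)

Lemma inS_star rho A z t : 0 < rho -> inS rho A z -> 0 <= t <= 1 -> inS rho A (RtoC t * z)%C.
Proof.
  intros Hrho [Hz|(r & th & Hr & Hth & ->)] Ht.
  - left. rewrite Cmod_mult, Cmod_R, Rabs_pos_eq by lra. pose proof (Cmod_ge_0 z). nra.
  - destruct (Req_dec t 0) as [->|Ht0].
    + left. rewrite Cmult_0_l, Cmod_0. easy.
    + right. exists (t * r), th. split; [apply Rmult_lt_0_compat; lra|]. split; [easy|].
      apply injective_projections; simpl; ring.
Qed.

Lemma Copen_and (U V : C -> Prop) : Copen U -> Copen V -> Copen (fun z => U z /\ V z).
Proof.
  intros HU HV z [Hu Hv]. destruct (HU z Hu) as [r [Hr H1]]. destruct (HV z Hv) as [s [Hs H2]].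
  exists (Rmin r s). split; [now apply Rmin_glb_lt|]. intros w Hw. apply Rmin_Rgt in Hw.
  split; [apply H1|apply H2]; lra.
Qed.

(** The intersection of the two domains need not be connected, but it contains the segment [0, z],
    which is all that [segment_identity] asks for. *)
Lemma borel_ext_unique rho A a f g z : 0 < rho -> borel_ext rho A a f -> borel_ext rho A a g ->
  inS rho A z -> f z = g z.
Proof.
  intros Hrho [(V1 & O1 & I1 & D1) (r1 & Hr1 & S1)] [(V2 & O2 & I2 & D2) (r2 & Hr2 & S2)] Hz.
  apply (proj2 (Ceq_minus _ _)).
  apply (segment_identity (fun z => V1 z /\ V2 z) (fun z => f z - g z)%C z (Rmin r1 r2)).
  - now apply Copen_and.
  - intros w [H1 H2]. apply cdif_minus; apply ex_derive_cder; [now apply D1|now apply D2].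
  - intros t Ht. split; [apply I1|apply I2]; now apply inS_star.
  - now apply Rmin_glb_lt.
  - intros w Hw. apply Rmin_Rgt in Hw. apply (proj1 (Ceq_minus _ _)).
    apply (cpseries_unique (borel_coef a) w); [apply S1|apply S2]; lra.
Qed.

(** The two extreme terms of the product involve a constant term and give a f2 + b f1. In the others
    the factorials undo the Borel transform, which leaves the coefficients of [conv_series]. *)
Lemma fmul_borel_coef a b k : borel_coef (fmul a b) k =
  (a O * borel_coef b k + (b O * borel_coef a k +
    match k with O => RtoC 0 | S k =>
    (/ RtoC (INR (fact (S k))) * csum (fun i => (RtoC (INR (fact i)) * borel_coef a i) *
        (RtoC (INR (fact (k - i))) * borel_coef b (k - i)%nat)) k)%C end))%C.
Proof.
  unfold borel_coef at 1, fmul.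
  change (sum_n (fun k0 => (a k0 * b (S k - k0)%nat)%C) (S k)) with (csum (fun k0 => (a k0 * b (S k - k0)%nat)%C) (S k)).
  assert (F0 : forall n, RtoC (INR (fact n)) <> RtoC 0).
  { intros n E. apply RtoC_inj in E. revert E. apply INR_fact_neq_0. }
  destruct k as [|k].
  - rewrite csum_S, csum_0. unfold borel_coef. simpl. ring.
  - rewrite csum_S, csum_shift, !Nat.sub_diag, Nat.sub_0_r.
    rewrite (csum_ext (fun i => RtoC (INR (fact i)) * borel_coef a i * (RtoC (INR (fact (k - i))) * borel_coef b (k - i)%nat))%C
      (fun i => a (S i) * b (S (S k) - S i)%nat)%C).
    + unfold borel_coef. rewrite !(RtoC_inv _ (INR_fact_neq_0 _)). ring.
    + intros i Hi. unfold borel_coef. rewrite !RtoC_inv by apply INR_fact_neq_0.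
      replace (S (S k) - S i)%nat with (S (k - i)) by lia. field. split; apply F0.
Qed.

Lemma borel_ext_fmul rho A a b f1 f2 : 0 < rho -> borel_ext rho A a f1 -> borel_ext rho A b f2 ->
  borel_ext rho A (fmul a b) (fun z => a O * f2 z + (b O * f1 z + conv f1 f2 z))%C.
Proof.
  intros Hrho [(V1 & O1 & I1 & D1) (r1 & Hr1 & S1)] [(V2 & O2 & I2 & D2) (r2 & Hr2 & S2)].
  set (V := fun z => V1 z /\ V2 z).
  assert (HV : Copen V) by now apply Copen_and.
  assert (IV : forall z, inS rho A z -> V z) by (intros z Hz; split; auto).
  assert (DV1 : forall w, V w -> cdif f1 w) by (intros w [Hw _]; now apply ex_derive_cder, D1).
  assert (DV2 : forall w, V w -> cdif f2 w) by (intros w [_ Hw]; now apply ex_derive_cder, D2).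
  split.
  (* [V] need not be star-shaped, so it is replaced by the points whose whole segment from 0 has a
     tube inside [V]. This set is open: halving the tube allows z to move. *)
  - exists (fun z => exists d, 0 < d /\ forall t w, 0 <= t <= 1 -> Cmod (w - RtoC t * z) < d -> V w).
    split; [|split].
    + intros z [d [Hd H]]. exists (d / 2). split; [lra|]. intros w Hw. exists (d / 2). split; [lra|].
      intros t v Ht Hv. apply (H t); [easy|].
      replace (v - t * z)%C with ((v - t * w) + RtoC t * (w - z))%C by ring.
      eapply Rle_lt_trans; [apply Cmod_triangle|]. rewrite Cmod_mult, Cmod_R, Rabs_pos_eq by lra.
      pose proof (Cmod_ge_0 (w - z)). nra.
    + intros z Hz. destruct (segment_tube V f1 z HV DV1) as [d [M [Hd H]]].
      * intros t Ht. now apply IV, inS_star.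
      * exists d. split; [easy|]. intros t w Ht Hw. now apply (H t w).
    + intros z [d [Hd H]]. apply ex_derive_cder.
      assert (Hseg : forall t, 0 <= t <= 1 -> V (RtoC t * z)%C).
      { intros t Ht. apply (H t); [easy|]. replace (_ - _)%C with (RtoC 0) by ring. now rewrite Cmod_0. }
      assert (Hz : V z) by (rewrite <- (Cmult_1_l z); apply Hseg; lra).
      apply cdif_plus; [apply cdif_mult; [apply cdif_const|auto]|].
      apply cdif_plus; [apply cdif_mult; [apply cdif_const|auto]|].
      now apply (conv_cdif V).
  - set (r := Rmin rho (Rmin r1 r2)).
    assert (Hr : 0 < r) by (repeat apply Rmin_glb_lt; easy).
    assert (Hsub : forall w, Cmod w < r -> V w /\ Cmod w < r1 /\ Cmod w < r2).
    { intros w Hw. apply Rmin_Rgt in Hw. destruct Hw as [Hw1 Hw2]. apply Rmin_Rgt in Hw2.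
      split; [apply IV; left; lra|lra]. }
    exists (r / 8). split; [lra|]. intros z Hz.
    assert (Hz' : Cmod z < r) by lra. destruct (Hsub z Hz') as (_ & Hz1 & Hz2).
    eapply (is_pseries_ext (K := C_AbsRing) (V := C_NormedModule)); [intros n; symmetry; apply fmul_borel_coef|].
    apply (is_pseries_plus (K := C_AbsRing) (V := C_NormedModule)
      (fun k => a O * borel_coef b k)%C).
    { apply (is_pseries_scal (K := C_AbsRing) (V := C_NormedModule) (a O)); [apply Cmult_comm|auto]. }
    apply (is_pseries_plus (K := C_AbsRing) (V := C_NormedModule) (fun k => b O * borel_coef a k)%C).
    { apply (is_pseries_scal (K := C_AbsRing) (V := C_NormedModule) (b O)); [apply Cmult_comm|auto]. }
    apply (conv_series _ _ f1 f2 r); auto; intros w Hw; destruct (Hsub w Hw) as (Hw0 & Hw1 & Hw2).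
    + now apply DV1.
    + now apply DV2.
    + now apply S1.
    + now apply S2.
Qed.

(** The factor -(k + 1) cancels one factor of (k + 1)!, which turns differentiation into a shift of
    the Borel coefficients with a change of sign. *)
Lemma borel_ext_fderiv rho A a f : borel_ext rho A a f ->
  borel_ext rho A (fderiv a) (fun z => - (z * f z))%C.
Proof.
  intros [(V & HO & HI & D) (r & Hr & S)]. split.
  - exists V. split; [easy|]. split; [easy|]. intros z Hz. apply ex_derive_cder, cdif_opp, cdif_mult; [apply cdif_id|].
    now apply ex_derive_cder, D.
  - exists r. split; [easy|]. intros z Hz.
    eapply (is_pseries_ext (K := C_AbsRing) (V := C_NormedModule)).
    2: { apply (is_pseries_opp (K := C_AbsRing) (V := C_NormedModule)),
          (is_pseries_incr_1 (K := C_AbsRing) (V := C_NormedModule)), S, Hz. }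
    intros [|k].
    + change (- 0 = borel_coef (fderiv a) 0)%C. unfold borel_coef, fderiv. simpl (INR 0).
      rewrite Ropp_0. ring.
    + change (- borel_coef a k = borel_coef (fderiv a) (Datatypes.S k))%C. unfold borel_coef, fderiv.
      change (fact (Datatypes.S k)) with (Datatypes.S k * fact k)%nat. rewrite mult_INR.
      assert (HS : INR (Datatypes.S k) <> 0) by now apply not_0_INR.
      assert (HF := INR_fact_neq_0 k).
      replace (/ (INR (Datatypes.S k) * INR (fact k))) with (/ INR (Datatypes.S k) * / INR (fact k)) by (now field).
      rewrite RtoC_mult.
      replace (RtoC (- INR (Datatypes.S k)) * a (Datatypes.S k) * (RtoC (/ INR (Datatypes.S k)) * RtoC (/ INR (fact k))))%C
       with (RtoC (- INR (Datatypes.S k)) * RtoC (/ INR (Datatypes.S k)) * (a (Datatypes.S k) * RtoC (/ INR (fact k))))%C by ring.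
      rewrite <- RtoC_mult. replace (- INR (Datatypes.S k) * / INR (Datatypes.S k)) with (- (1)) by now field.
      rewrite RtoC_opp. ring.
Qed.

Lemma borel_ext_fderiv_n N rho A a f : borel_ext rho A a f ->
  borel_ext rho A (fderiv_n N a) (fun z => (- z) ^ N * f z)%C.
Proof.
  intros H. induction N as [|N IH].
  - replace (fun z => (- z) ^ 0 * f z)%C with f; [easy|].
    apply functional_extensionality. intros z. simpl. ring.
  - apply borel_ext_fderiv in IH.
    replace (fun z => (- z) ^ S N * f z)%C with (fun z => - (z * ((- z) ^ N * f z)))%C; [exact IH|].
    apply functional_extensionality. intros z. rewrite Cpow_S. ring.
Qed.

(** * Weighted norms and exponential bounds *)

Definition exp_bounded rho A tau M (f : C -> C) : Prop :=
  forall z, inS rho A z -> Cmod (f z) <= M * exp (tau * Cmod z).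

Lemma inS_0 rho A : 0 < rho -> inS rho A 0.
Proof. intros H. left. now rewrite Cmod_0. Qed.

Lemma snorm_le rho A tau a f M : exp_bounded rho A tau M f ->
  Rbar_le (snorm rho A tau a f) (Cmod (a O) + M).
Proof.
  intros H. unfold snorm.
  assert (HL : Rbar_le (Lub_Rbar (fun x => exists z, inS rho A z /\ x = exp (- tau * Cmod z) * Cmod (f z))) M).
  { apply (proj2 (Lub_Rbar_correct _)). intros x [z [Hz ->]]. simpl.
    specialize (H z Hz). replace (- tau * Cmod z) with (- (tau * Cmod z)) by ring. rewrite exp_Ropp.
    pose proof (exp_pos (tau * Cmod z)). rewrite Rmult_comm. now apply Rle_div_l. }
  destruct (Lub_Rbar _); simpl in *; try easy. lra.
Qed.

(** The point 0 lies in S(rho, A), so the supremum is at least 0 and cannot be minus infinity; when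
    finite, it is itself the best constant M. *)
Lemma snorm_cases rho A tau a f : 0 < rho ->
  snorm rho A tau a f = p_infty \/
  exists M, 0 <= M /\ exp_bounded rho A tau M f /\ snorm rho A tau a f = Finite (Cmod (a O) + M).
Proof.
  intros Hrho. unfold snorm. set (E := fun x => _).
  destruct (Lub_Rbar_correct E) as [Hub _].
  assert (H0 : Rbar_le 0 (Lub_Rbar E)).
  { eapply Rbar_le_trans; [|apply Hub; exists (RtoC 0); split; [now apply inS_0|reflexivity]].
    simpl. apply Rmult_le_pos; [apply Rlt_le, exp_pos|apply Cmod_ge_0]. }
  destruct (Lub_Rbar E) as [M| |]; [right|now left|easy].
  exists M. split; [easy|]. split; [|reflexivity].
  intros z Hz. specialize (Hub _ (ex_intro _ z (conj Hz eq_refl))). simpl in Hub.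
  replace (- tau * Cmod z) with (- (tau * Cmod z)) in Hub by ring. rewrite exp_Ropp, Rmult_comm in Hub.
  apply Rle_div_l in Hub; [easy|apply exp_pos].
Qed.

Lemma snorm_ge_0 rho A tau a f : 0 < rho -> Rbar_le 0 (snorm rho A tau a f).
Proof.
  intros Hrho. destruct (snorm_cases rho A tau a f Hrho) as [->|(M & HM & _ & ->)]; simpl; [easy|].
  pose proof (Cmod_ge_0 (a O)). lra.
Qed.

Lemma borel_ext_ccont rho A a f z : borel_ext rho A a f -> inS rho A z -> ccont f z.
Proof. intros [(V & _ & HI & D) _] Hz. apply cdif_ccont. now apply ex_derive_cder, D, HI. Qed.

(* Putting the weight [tau] on [f1] and [tau + eps] on [f2] costs only one factor [1/eps]. *)
Lemma conv_bound rho A a b f1 f2 tau eps M1 M2 : 0 < rho -> 0 < eps ->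
  borel_ext rho A a f1 -> borel_ext rho A b f2 -> 0 <= M1 -> 0 <= M2 ->
  exp_bounded rho A tau M1 f1 -> exp_bounded rho A (tau + eps) M2 f2 ->
  exp_bounded rho A (tau + eps) (M1 * M2 / eps) (conv f1 f2).
Proof.
  intros Hrho Heps B1 B2 HM1 HM2 H1 H2 z Hz.
  assert (Hs : forall t, 0 <= t <= 1 -> inS rho A (RtoC t * z)%C) by (intros; now apply inS_star).
  assert (Hseg : cseg (fun t => f1 (t * z) * f2 ((1 - t) * z))%C 0 1).
  { apply cseg_conv; intros t Ht; eapply borel_ext_ccont; eauto. }
  set (x := Cmod z). assert (Hx : 0 <= x) by apply Cmod_ge_0.
  set (K := M1 * M2 * exp (tau * x)).
  assert (HM : 0 <= M1 * M2) by now apply Rmult_le_pos.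
  assert (HK : 0 <= K) by (apply Rmult_le_pos; [easy|apply Rlt_le, exp_pos]).
  unfold conv. rewrite <- cint_scal; [|lra|easy].
  (* The exponents tau t x and (tau + eps) (1 - t) x add up to tau x + eps (1 - t) x. This primitive
     of the majorant divides by eps only, so x = 0 needs no separate treatment. *)
  apply Rle_trans with (- (K / eps) * exp (eps * (1 - 1) * x) - - (K / eps) * exp (eps * (1 - 0) * x)).
  - apply (cint_le _ (fun t => K * x * exp (eps * (1 - t) * x))); [lra|now apply cseg_scal| |].
    + apply (is_RInt_derive (V := R_CompleteNormedModule) (fun t => - (K / eps) * exp (eps * (1 - t) * x))).
      * intros t _. auto_derive; [easy|]. replace (1 + - t) with (1 - t) by ring. field. lra.
      * intros t _. apply (ex_derive_continuous (V := R_NormedModule)). auto_derive. easy.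
    + intros t Ht. rewrite !Cmod_mult, <- RtoC_minus. fold x.
      assert (E1 := H1 _ (Hs t Ht)). assert (E2 := H2 _ (Hs (1 - t) ltac:(lra))).
      rewrite Cmod_mult, Cmod_R, Rabs_pos_eq in E1, E2 by lra. fold x in E1, E2.
      apply Rle_trans with (x * (M1 * exp (tau * (t * x)) * (M2 * exp ((tau + eps) * ((1 - t) * x))))).
      * apply Rmult_le_compat_l; [easy|]. apply Rmult_le_compat; try apply Cmod_ge_0; easy.
      * right. unfold K.
        replace (x * (M1 * exp (tau * (t * x)) * (M2 * exp ((tau + eps) * ((1 - t) * x)))))
          with (M1 * M2 * x * (exp (tau * (t * x)) * exp ((tau + eps) * ((1 - t) * x)))) by ring.
        replace (M1 * M2 * exp (tau * x) * x * exp (eps * (1 - t) * x)) with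
          (M1 * M2 * x * (exp (tau * x) * exp (eps * (1 - t) * x))) by ring.
        rewrite <- !exp_plus. do 2 f_equal. ring.
  - replace (M1 * M2 / eps * exp ((tau + eps) * x)) with (K / eps * exp (eps * (1 - 0) * x)).
    2: { unfold K. replace ((tau + eps) * x) with (tau * x + eps * (1 - 0) * x) by ring. rewrite exp_plus. field. lra. }
    assert (0 <= K / eps * exp (eps * (1 - 1) * x)); [|lra].
    apply Rmult_le_pos; [now apply Rdiv_le_0_compat|apply Rlt_le, exp_pos].
Qed.

Lemma exp_bounded_weaken rho A tau eps M f : 0 <= eps -> 0 <= M -> exp_bounded rho A tau M f ->
  exp_bounded rho A (tau + eps) M f.
Proof.
  intros He HM H z Hz. eapply Rle_trans; [apply H, Hz|]. apply Rmult_le_compat_l; [easy|].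
  apply exp_le_mono. pose proof (Cmod_ge_0 z). nra.
Qed.

Lemma exp_bounded_0 rho A tau f : exp_bounded rho A tau 0 f <-> forall z, inS rho A z -> f z = 0.
Proof.
  split; intros H z Hz.
  - apply Cmod_eq_0, Rle_antisym; [|apply Cmod_ge_0]. eapply Rle_trans; [apply H, Hz|lra].
  - rewrite H, Cmod_0 by easy. lra.
Qed.

Lemma conv_zero rho A (f1 f2 : C -> C) z : 0 < rho -> inS rho A z ->
  (forall w, inS rho A w -> f1 w = 0) \/ (forall w, inS rho A w -> f2 w = 0) -> conv f1 f2 z = 0.
Proof.
  intros Hrho Hz H. unfold conv. rewrite (cint_ext _ (fun _ => 0)), cint_const; [ring|lra|].
  intros t Ht. rewrite <- RtoC_minus.
  destruct H as [H|H]; rewrite (H (_ * z)%C) by (apply inS_star; auto; lra); ring.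
Qed.

Lemma fmul_0 a b : fmul a b O = (a O * b O)%C.
Proof. apply csum_0. Qed.

Lemma snorm_eq_0 rho A tau a f : 0 < rho -> snorm rho A tau a f = Finite 0 ->
  a O = 0 /\ forall z, inS rho A z -> f z = 0.
Proof.
  intros Hrho H. destruct (snorm_cases rho A tau a f Hrho) as [E|(M & HM & HB & E)]; rewrite E in H; [easy|].
  injection H as H. pose proof (Cmod_ge_0 (a O)). split.
  - apply Cmod_eq_0. lra.
  - apply (exp_bounded_0 rho A tau). now replace 0 with M by lra.
Qed.

(** If one norm is infinite and the other 0, the right-hand side is 0 by convention, and [Hzero]
    shows that the product has norm 0. In the finite case the four terms of (|a 0| + M1) (|b 0| +
    M2) are compared separately: M1 M2 / eps uses K >= 1/eps, the others K >= 1. *)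
Lemma snorm_fmul rho A tau eps a b f1 f2 g : 0 < rho -> 0 < eps ->
  borel_ext rho A a f1 -> borel_ext rho A b f2 -> borel_ext rho A (fmul a b) g ->
  Rbar_le (snorm rho A (tau + eps) (fmul a b) g)
   (Rbar_mult (Finite (Rmax 1 (/ eps))) (Rbar_mult (snorm rho A tau a f1) (snorm rho A (tau + eps) b f2))).
Proof.
  intros Hrho Heps B1 B2 Bg. set (K := Rmax 1 (/ eps)).
  assert (HK1 : 1 <= K) by apply Rmax_l. assert (HK2 : / eps <= K) by apply Rmax_r.
  assert (Hg : forall z, inS rho A z -> g z = (a O * f2 z + (b O * f1 z + conv f1 f2 z))%C).
  { intros z Hz. exact (borel_ext_unique rho A _ _ _ z Hrho Bg (borel_ext_fmul _ _ _ _ _ _ Hrho B1 B2) Hz). }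
  assert (Hzero : (a O = 0 /\ forall z, inS rho A z -> f1 z = 0) \/ (b O = 0 /\ forall z, inS rho A z -> f2 z = 0) ->
     Rbar_le (snorm rho A (tau + eps) (fmul a b) g) 0).
  { intros Hz. replace (Finite 0) with (Finite (Cmod (fmul a b O) + 0)).
    - apply snorm_le, exp_bounded_0. intros z Hin. rewrite Hg by easy.
      rewrite (conv_zero rho A f1 f2 z Hrho Hin) by tauto.
      destruct Hz as [[E1 E2]|[E1 E2]]; rewrite E1, E2 by easy; ring.
    - f_equal. rewrite fmul_0. destruct Hz as [[-> _]|[-> _]];
      rewrite ?Cmult_0_l, ?Cmult_0_r, Cmod_0; ring. }
  destruct (snorm_cases rho A tau a f1 Hrho) as [E1|(M1 & HM1 & HB1 & E1)];
  destruct (snorm_cases rho A (tau + eps) b f2 Hrho) as [E2|(M2 & HM2 & HB2 & E2)].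
  - rewrite E1, E2. simpl. destruct (Rle_dec 0 K) as [H|]; [|lra]. destruct (Rle_lt_or_eq_dec 0 K H); [|lra].
    now destruct (snorm rho A (tau + eps) (fmul a b) g).
  - pose proof (Cmod_ge_0 (b O)) as Hb. destruct (Req_dec (Cmod (b O) + M2) 0) as [Hz|Hz].
    + rewrite E2, Hz, Rbar_mult_0_r, Rbar_mult_0_r. apply Hzero. right.
      apply (snorm_eq_0 rho A (tau + eps)); [easy|]. now rewrite E2, Hz.
    + rewrite E1, E2. simpl. destruct (Rle_dec 0 (Cmod (b O) + M2)) as [H|]; [|lra].
      destruct (Rle_lt_or_eq_dec 0 _ H); [|lra]. simpl.
      destruct (Rle_dec 0 K) as [H'|]; [|lra]. destruct (Rle_lt_or_eq_dec 0 K H'); [|lra].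
      now destruct (snorm rho A (tau + eps) (fmul a b) g).
  - pose proof (Cmod_ge_0 (a O)) as Hb. destruct (Req_dec (Cmod (a O) + M1) 0) as [Hz|Hz].
    + rewrite E1, Hz, Rbar_mult_0_l, Rbar_mult_0_r. apply Hzero. left.
      apply (snorm_eq_0 rho A tau); [easy|]. now rewrite E1, Hz.
    + rewrite E1, E2. simpl. destruct (Rle_dec 0 (Cmod (a O) + M1)) as [H|]; [|lra].
      destruct (Rle_lt_or_eq_dec 0 _ H); [|lra]. simpl.
      destruct (Rle_dec 0 K) as [H'|]; [|lra]. destruct (Rle_lt_or_eq_dec 0 K H'); [|lra].
      now destruct (snorm rho A (tau + eps) (fmul a b) g).
  - rewrite E1, E2. pose proof (Cmod_ge_0 (a O)) as Ha. pose proof (Cmod_ge_0 (b O)) as Hb.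
    set (ca := Cmod (a O)) in *. set (cb := Cmod (b O)) in *.
    eapply Rbar_le_trans; [apply (snorm_le _ _ _ _ _ (ca * M2 + (cb * M1 + M1 * M2 / eps)))|].
    + assert (HB1' := exp_bounded_weaken _ _ _ eps _ _ (Rlt_le _ _ Heps) HM1 HB1).
      assert (HBc := conv_bound rho A a b f1 f2 tau eps M1 M2 Hrho Heps B1 B2 HM1 HM2 HB1 HB2).
      intros z Hz. rewrite Hg by easy.
      specialize (HB1' z Hz). specialize (HB2 z Hz). specialize (HBc z Hz).
      eapply Rle_trans; [apply Cmod_triangle|].
      pose proof (Cmod_triangle (b O * f1 z) (conv f1 f2 z)) as HT.
      rewrite !Cmod_mult in HT |- *. fold ca cb in HT |- *.
      assert (ca * Cmod (f2 z) <= ca * (M2 * exp ((tau + eps) * Cmod z))) by now apply Rmult_le_compat_l.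
      assert (cb * Cmod (f1 z) <= cb * (M1 * exp ((tau + eps) * Cmod z))) by now apply Rmult_le_compat_l.
      lra.
    + rewrite fmul_0, Cmod_mult. simpl. fold ca cb.
      assert (0 <= ca * cb) by now apply Rmult_le_pos. assert (0 <= ca * M2) by now apply Rmult_le_pos.
      assert (0 <= cb * M1) by now apply Rmult_le_pos. assert (0 <= M1 * M2) by now apply Rmult_le_pos.
      unfold Rdiv. nra.
Qed.

(** * Products of several factors *)

(** The delicate case is x infinite and w = 0, where the right-hand side is 0: then y <= L w forces
    y = 0, and the left-hand side is 0 as well. *)
Lemma Rbar_mult_le_chain (K L : R) (x y z w : Rbar) : 0 < K -> 0 < L ->
  Rbar_le 0 x -> Rbar_le 0 y -> Rbar_le 0 w -> Rbar_le z (Rbar_mult K (Rbar_mult x y)) ->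
  Rbar_le y (Rbar_mult L w) -> Rbar_le z (Rbar_mult (K * L) (Rbar_mult x w)).
Proof.
  intros HK HL Hx Hy Hw Hz Hyw.
  assert (HKL : 0 < K * L) by now apply Rmult_lt_0_compat.
  assert (Hpos : forall c : R, 0 < c -> forall r : R, 0 <= r -> Rbar_le 0 (c * r)).
  { intros c Hc r Hr. simpl. apply Rmult_le_pos; lra. }
  assert (Hinf : forall c : R, 0 < c -> Rbar_mult c p_infty = p_infty).
  { intros c Hc. simpl. destruct (Rle_dec 0 c) as [H|]; [|lra]. now destruct (Rle_lt_or_eq_dec 0 c H); [|lra]. }
  eapply Rbar_le_trans; [apply Hz|].
  destruct w as [w| |]; [| |easy].
  - destruct y as [y| |]; [|easy|easy]. simpl in Hy, Hw, Hyw.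
    destruct x as [x| |]; [| |easy].
    + simpl in *. rewrite Rmult_assoc. apply Rmult_le_compat_l; [lra|].
      replace (L * (x * w)) with (x * (L * w)) by ring. now apply Rmult_le_compat_l.
    + destruct (Req_dec y 0) as [->|Hy0].
      * rewrite Rbar_mult_0_r, Rbar_mult_0_r. destruct (Req_dec w 0) as [->|Hw0].
        -- rewrite Rbar_mult_0_r, Rbar_mult_0_r. apply Rbar_le_refl.
        -- rewrite (Rbar_mult_comm p_infty), !Hinf by lra. easy.
      * assert (Hw0 : 0 < w) by nra. rewrite (Rbar_mult_comm _ w), (Hinf w), (Hinf (K * L)) by easy.
        now destruct (Rbar_mult K (Rbar_mult p_infty y)).
  - destruct x as [x| |]; [| |easy].
    + simpl in Hx. destruct (Req_dec x 0) as [->|Hx0].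
      * rewrite !Rbar_mult_0_l, !Rbar_mult_0_r. apply Rbar_le_refl.
      * rewrite (Hinf x), (Hinf (K * L)) by lra. now destruct (Rbar_mult K (Rbar_mult x y)).
    + change (Rbar_mult p_infty p_infty) with p_infty. rewrite Hinf by easy.
      now destruct (Rbar_mult K (Rbar_mult p_infty y)).
Qed.

Lemma fmul_fone a : fmul a fone = a.
Proof.
  apply functional_extensionality. intros n. unfold fmul.
  change (csum (fun k => a k * fone (n - k)%nat)%C n = a n).
  destruct n as [|n].
  - rewrite csum_0. simpl. ring.
  - rewrite csum_S, Nat.sub_diag.
    rewrite (csum_ext _ (fun k => 0 * a k)%C), csum_scal; [simpl; ring|].
    intros k Hk. replace (S n - k)%nat with (S (n - k)) by lia. simpl. ring.
Qed.

(** The base case of the induction on factors; [f] and [g] need only agree on S(rho, A), which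
    uniqueness provides. *)
Lemma snorm_mono rho A tau eps a f g : 0 < rho -> 0 <= eps -> borel_ext rho A a f -> borel_ext rho A a g ->
  Rbar_le (snorm rho A (tau + eps) a g) (snorm rho A tau a f).
Proof.
  intros Hrho He Bf Bg. destruct (snorm_cases rho A tau a f Hrho) as [->|(M & HM & HB & ->)].
  - now destruct (snorm rho A (tau + eps) a g).
  - apply snorm_le. intros z Hz. rewrite (borel_ext_unique rho A a g f z) by easy.
    now apply (exp_bounded_weaken rho A tau eps M f He HM HB).
Qed.

Lemma Rbar_mult_ge_0 (x y : Rbar) : Rbar_le 0 x -> Rbar_le 0 y -> Rbar_le 0 (Rbar_mult x y).
Proof.
  intros Hx Hy. destruct x as [x| |]; [| |easy]; (destruct y as [y| |]; [| |easy]); simpl in *.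
  - now apply Rmult_le_pos.
  - destruct (Rle_dec 0 x) as [H|]; [|easy]. destruct (Rle_lt_or_eq_dec 0 x H); simpl; lra || easy.
  - destruct (Rle_dec 0 y) as [H|]; [|easy]. destruct (Rle_lt_or_eq_dec 0 y H); simpl; lra || easy.
  - easy.
Qed.

Lemma Rbar_prod_ge_0 (x : nat -> Rbar) l : (forall j, Rbar_le 0 (x j)) ->
  Rbar_le 0 (fold_right Rbar_mult (Finite 1) (map x l)).
Proof.
  intros H. induction l as [|j l IH]; simpl; [lra|]. now apply Rbar_mult_ge_0.
Qed.

(** There are n + 1 factors and n multiplications, hence the exponent n. The starting index s is
    arbitrary so that the induction hypothesis applies to the tail, and the tail's extension comes
    from the existence half of the same hypothesis. *)
Lemma snorm_fold_fmul rho A (phi : nat -> fseries) (f : nat -> C -> C) tau eps n s : 0 < rho -> 0 < eps ->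
  (forall j, (s <= j <= s + n)%nat -> borel_ext rho A (phi j) (f j)) ->
  let P := fold_right fmul fone (map phi (seq s (S n))) in
  (exists g, borel_ext rho A P g) /\
  forall g, borel_ext rho A P g ->
    Rbar_le (snorm rho A (tau + eps) P g)
      (Rbar_mult (Finite (Rmax 1 (/ eps) ^ n))
        (fold_right Rbar_mult (Finite 1) (map (fun j => snorm rho A tau (phi j) (f j)) (seq s (S n))))).
Proof.
  intros Hrho Heps. set (K := Rmax 1 (/ eps)). assert (HK : 1 <= K) by apply Rmax_l.
  revert s. induction n as [|n IH]; intros s Hf P.
  - unfold P. simpl. rewrite fmul_fone. split; [exists (f s); apply Hf; lia|].
    intros g Hg. rewrite (Rbar_mult_comm _ 1).
    assert (E : forall x, Rbar_mult 1 x = x).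
    { intros [x| |]; simpl; [f_equal; ring|..]; (destruct (Rle_dec 0 1) as [H|]; [|lra]);
      now destruct (Rle_lt_or_eq_dec 0 1 H); [|lra]. }
    rewrite !E. apply snorm_mono; auto; [lra|]. apply Hf. lia.
  - destruct (IH (S s)) as [[g' Hg'] Hle]; [intros j Hj; apply Hf; lia|].
    assert (Hs : borel_ext rho A (phi s) (f s)) by (apply Hf; lia).
    unfold P. clear P. change (seq s (S (S n))) with (s :: seq (S s) (S n)).
    revert Hg' Hle. generalize (seq (S s) (S n)) as l. intros l Hg' Hle. specialize (Hle g' Hg').
    cbn [map fold_right].
    split; [eexists; exact (borel_ext_fmul _ _ _ _ _ _ Hrho Hs Hg')|]. intros g Hg.
    apply (Rbar_mult_le_chain K (K ^ n) _ (snorm rho A (tau + eps) (fold_right fmul fone (map phi l)) g')).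
    + lra.
    + apply pow_lt. lra.
    + now apply snorm_ge_0.
    + now apply snorm_ge_0.
    + apply Rbar_prod_ge_0. intros j. now apply snorm_ge_0.
    + now apply (snorm_fmul rho A tau eps _ _ (f s) g').
    + exact Hle.
Qed.

(** * Derivatives *)

Lemma pow_le_fact_exp x N : 0 <= x -> x ^ N <= INR (fact N) * exp x.
Proof.
  intros Hx. pose proof (exp_ge_taylor x N Hx) as H.
  assert (HF : 0 < INR (fact N)) by apply INR_fact_lt_0.
  assert (HN : x ^ N / INR (fact N) <= exp x).
  { assert (Hp : forall n, 0 <= x ^ n / INR (fact n)).
    { intros n. apply Rdiv_le_0_compat; [now apply pow_le|apply INR_fact_lt_0]. }
    destruct N as [|N]; [exact H|]. rewrite tech5 in H.
    pose proof (cond_pos_sum (fun k => x ^ k / INR (fact k)) N Hp). lra. }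
  apply Rle_div_l in HN; [|easy]. lra.
Qed.

Lemma snorm_fderiv_n rho A tau eps N a f g : 0 < rho -> 0 < eps -> borel_ext rho A a f ->
  borel_ext rho A (fderiv_n N a) g ->
  Rbar_le (snorm rho A (tau + eps) (fderiv_n N a) g)
    (Rbar_mult (Finite (INR (fact N) / eps ^ N)) (snorm rho A tau a f)).
Proof.
  intros Hrho Heps Bf Bg. set (K := INR (fact N) / eps ^ N).
  assert (HK : 0 < K) by (apply Rdiv_lt_0_compat; [apply INR_fact_lt_0|now apply pow_lt]).
  destruct (snorm_cases rho A tau a f Hrho) as [->|(M & HM & HB & ->)].
  - simpl. destruct (Rle_dec 0 K) as [H|]; [|lra]. destruct (Rle_lt_or_eq_dec 0 K H); [|lra].
    now destruct (snorm rho A (tau + eps) (fderiv_n N a) g).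
  - eapply Rbar_le_trans; [apply (snorm_le _ _ _ _ _ (K * M))|].
    + intros z Hz. rewrite (borel_ext_unique rho A _ g _ z Hrho Bg (borel_ext_fderiv_n N rho A a f Bf) Hz).
      rewrite Cmod_mult, Cmod_pow, Cmod_opp. set (x := Cmod z). assert (Hx : 0 <= x) by apply Cmod_ge_0.
      specialize (HB z Hz). fold x in HB.
      assert (HE := pow_le_fact_exp (eps * x) N ltac:(now apply Rmult_le_pos; lra)).
      rewrite Rpow_mult_distr in HE.
      assert (HxN : x ^ N <= K * exp (eps * x)).
      { unfold K. replace (INR (fact N) / eps ^ N * exp (eps * x)) with (INR (fact N) * exp (eps * x) / eps ^ N)
          by (field; apply pow_nonzero; lra).
        apply Rle_div_r; [now apply pow_lt|]. lra. }
      apply Rle_trans with (K * exp (eps * x) * (M * exp (tau * x))).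
      * apply Rmult_le_compat; [now apply pow_le|apply Cmod_ge_0|easy|easy].
      * right. replace ((tau + eps) * x) with (tau * x + eps * x) by ring. rewrite exp_plus. ring.
    + simpl. rewrite Rmult_plus_distr_l. apply Rplus_le_compat_r.
      (* A derivative has no constant term, so |a 0| survives only for N = 0, where K = 1. *)
      destruct N as [|N].
      * unfold K. simpl. lra.
      * change (fderiv_n (S N) a O) with (RtoC 0). rewrite Cmod_0.
        apply Rmult_le_pos; [lra|apply Cmod_ge_0].
Qed.

(** The n-th power is monotone on nonnegative reals and fixes 1. This turns the constant accumulated
    in the induction into the stated one. *)
Lemma Rmax_1_pow x n : 0 <= x -> Rmax 1 x ^ n = Rmax 1 (x ^ n).
Proof.
  intros Hx. destruct (Rle_dec 1 x) as [H|H].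
  - rewrite Rmax_right by easy. rewrite Rmax_right; [easy|]. now apply pow_R1_Rle.
  - rewrite Rmax_left, pow1 by lra. rewrite Rmax_left; [easy|].
    rewrite <- (pow1 n). apply pow_incr. lra.
Qed.

Theorem theorem2 (A : R -> Prop) (hA : nontrivial_interval A)
  (n : nat) (hn : (1 <= n)%nat)
  (phi : nat -> fseries) (hphi : forall j, (j < n)%nat -> summable1 A (phi j))
  (N : nat)
  (rho : R) (hrho : 0 < rho)
  (f : nat -> C -> C) (hf : forall j, (j < n)%nat -> borel_ext rho A (phi j) (f j))
  (tau eps : R) (heps : 0 < eps) :
  ((exists g, borel_ext rho A (fprod n phi) g) /\
   forall g, borel_ext rho A (fprod n phi) g ->
     Rbar_le (snorm rho A (tau + eps) (fprod n phi) g)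
             (Rbar_mult (Finite (Rmax 1 (/ eps ^ (n - 1))))
                        (Rbar_prod n (fun j => snorm rho A tau (phi j) (f j))))) /\
  ((exists h, borel_ext rho A (fderiv_n N (phi 0%nat)) h) /\
   forall h, borel_ext rho A (fderiv_n N (phi 0%nat)) h ->
     Rbar_le (snorm rho A (tau + eps) (fderiv_n N (phi 0%nat)) h)
             (Rbar_mult (Finite (INR (fact N) / eps ^ N))
                        (snorm rho A tau (phi 0%nat) (f 0%nat)))).
Proof.
  split.
  - destruct n as [|n]; [lia|]. simpl (S n - 1)%nat. rewrite Nat.sub_0_r.
    rewrite <- pow_inv, <- Rmax_1_pow by (apply Rlt_le, Rinv_0_lt_compat, heps).
    apply (snorm_fold_fmul rho A phi f tau eps n 0); auto. intros j Hj. apply hf. lia.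
  - split.
    + eexists. apply borel_ext_fderiv_n, hf. lia.
    + intros h. apply snorm_fderiv_n; auto.
Qed.
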